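(* For $m\in\{6,7,8\}$ let $E_m$ be the tree on $m$ vertices consisting of a path $p_1-p_2-\cdots-p_{m-1}$ together with one extra vertex $q$ joined to $p_3$. Then all relations among the edge generators of $\mathcal E_{E_m}$ are generated by the quadratic relations ($X_e^2$ for edges $e$, $X_eX_f-X_fX_e$ for disjoint edges), the braid relations $X_{ja}X_{jb}X_{ja}+X_{jb}X_{ja}X_{jb}$ (edges $\{j,a\},\{j,b\}$ sharing $j$) and the claw relations $X_{ja}X_{jb}X_{jc}X_{ja}+X_{jb}X_{jc}X_{ja}X_{jb}+X_{jc}X_{ja}X_{jb}X_{jc}$ (edges $\{j,a\},\{j,b\},\{j,c\}$ sharing $j$), where $X_{ja}$ denotes the generator $x_{ja}$. Moreover $$\mathcal H_{E_6}(t)=\frac{[4][5][6]^2[8][9]}{[3]},\quad \mathcal H_{E_7}(t)=\frac{[6]^2[8][9][10][12][14]}{[3]},\quad \mathcal H_{E_8}(t)=\frac{[6][8][10][12][14][15][18][20][24]}{[3][5]}.$$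
   Context: Let $n\ge 1$. The Fomin–Kirillov algebra $\mathcal E_n$ is the associative $\mathbb Q$-algebra with generators $x_{ij}$ for ordered pairs of distinct $i,j\in[n]$, subject to $x_{ij}=-x_{ji}$, $x_{ij}^2=0$, $x_{ij}x_{kl}=x_{kl}x_{ij}$ for distinct $i,j,k,l$, and $x_{ij}x_{jk}+x_{jk}x_{ki}+x_{ki}x_{ij}=0$ for distinct $i,j,k$. It is graded by degree. For a simple graph $G$ on vertex set identified with $[n]$, $\mathcal E_G$ is the subalgebra of $\mathcal E_n$ generated by the $x_{ij}$ with $\{i,j\}$ an edge of $G$; ''all relations are generated by'' means the kernel of the surjection from the free algebra on one symbol per edge onto $\mathcal E_G$ is generated as a two-sided ideal by the listed elements. $\mathcal H_G(t)=\sum_d\dim\mathcal E_G^d\,t^d$ and $[k]=1+t+\cdots+t^{k-1}$. *)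

(* Defs.v *)
From HB Require Import structures.
From mathcomp Require Import all_boot all_order all_algebra.
Set Implicit Arguments. Unset Strict Implicit. Unset Printing Implicit Defensive.
Import Order.TTheory GRing.Theory Num.Theory.
Local Open Scope ring_scope.

(* An element is a formal finite Q-linear combination of words; two
   representations denote the same element iff they have the same
   coefficient on every word (fa_eq). *)
Definition fa (V : eqType) := seq (rat * seq V).

Section FreeAlg.
Variable V : eqType.
Definition fa_coef (p : fa V) (w : seq V) : rat := \sum_(cw <- p | cw.2 == w) cw.1.
Definition fa_eq (p q : fa V) : Prop := forall w, fa_coef p w = fa_coef q w.
Definition fa_add (p q : fa V) : fa V := p ++ q.
Definition fa_scale (c : rat) (p : fa V) : fa V := [seq (c * cw.1, cw.2) | cw <- p].
Definition fa_opp (p : fa V) : fa V := fa_scale (-1) p.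
Definition fa_mul (p q : fa V) : fa V := [seq (a.1 * b.1, a.2 ++ b.2) | a <- p, b <- q].
Definition fa_word (w : seq V) : fa V := [:: (1, w)].
Definition in_ideal (S : fa V -> Prop) (p : fa V) : Prop :=
  exists L : seq (rat * seq V * fa V * seq V),
    (forall t, t \in L -> S t.1.2) /\
    fa_eq p (flatten [seq fa_scale t.1.1.1
                           (fa_mul (fa_word t.1.1.2) (fa_mul t.1.2 (fa_word t.2)))
                     | t <- L]).
Definition fa_homog (d : nat) (p : fa V) : bool := all (fun cw => size cw.2 == d) p.
Definition fa_lincomb (cs : seq rat) (ps : seq (fa V)) : fa V :=
  flatten [seq fa_scale t.1 t.2 | t <- zip cs ps].
End FreeAlg.

Definition fa_map (U V : eqType) (f : U -> V) (p : fa U) : fa V :=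
  [seq (cw.1, map f cw.2) | cw <- p].

(* Letters: ordered pairs (i,j) of 'I_n.  The diagonal letters (i,i) are
   killed by an extra relation, so the quotient is the free algebra on the
   x_ij, i <> j, modulo the FK relations. *)
Definition FKgen (n : nat) : eqType := ('I_n * 'I_n)%type.
Definition xFK (n : nat) (i j : 'I_n) : fa (FKgen n) := fa_word [:: ((i, j) : FKgen n)].

Definition FK_rel (n : nat) (r : fa (FKgen n)) : Prop :=
  (exists i : 'I_n, r = xFK i i) \/
  (exists i j : 'I_n, i != j /\ r = fa_add (xFK i j) (xFK j i)) \/
  (exists i j : 'I_n, i != j /\ r = fa_mul (xFK i j) (xFK i j)) \/
  (exists i j k l : 'I_n, uniq [:: i; j; k; l] /\
     r = fa_add (fa_mul (xFK i j) (xFK k l)) (fa_opp (fa_mul (xFK k l) (xFK i j)))) \/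
  (exists i j k : 'I_n, uniq [:: i; j; k] /\
     r = fa_add (fa_mul (xFK i j) (xFK j k))
           (fa_add (fa_mul (xFK j k) (xFK k i)) (fa_mul (xFK k i) (xFK i j)))).

(* edges of a simple graph G (symmetric irreflexive rel on 'I_n), as pairs (a,b), a<b *)
Definition Edge (n : nat) (G : rel 'I_n) : Type :=
  {p : 'I_n * 'I_n | ((p.1 < p.2)%N && G p.1 p.2)}.
HB.instance Definition _ (n : nat) (G : rel 'I_n) :=
  [Equality of Edge G by <:].

Section Graph.
Variables (n : nat) (G : rel 'I_n).

(* the surjection F<edges> -> E_G (followed by the inclusion into E_n),
   lifted to free algebras: edge {a<b} |-> x_ab *)
Definition edge_letter (e : Edge G) : FKgen n := val e.
Definition phiG (p : fa (Edge G)) : fa (FKgen n) := fa_map edge_letter p.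

Definition kerG (p : fa (Edge G)) : Prop := in_ideal (@FK_rel n) (phiG p).

(* X_{ja}: the edge generator of {j,a}, with the convention X_{ja} = - X_{aj},
   matching x_{ja} = - x_{aj} *)
Definition Xo (j a : 'I_n) : fa (Edge G) :=
  if (j < a)%N then
    (if (insub (j, a) : option (Edge G)) is Some e then fa_word [:: e] else [::])
  else
    (if (insub (a, j) : option (Edge G)) is Some e then fa_opp (fa_word [:: e]) else [::]).

Definition edges_disjoint (e f : Edge G) : bool :=
  uniq [:: (val e).1; (val e).2; (val f).1; (val f).2].

Definition listed_rel (r : fa (Edge G)) : Prop :=
  (exists e : Edge G, r = fa_word [:: e; e]) \/
  (exists e f : Edge G, edges_disjoint e f /\
     r = fa_add (fa_word [:: e; f]) (fa_opp (fa_word [:: f; e]))) \/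
  (exists j a b : 'I_n, a != b /\ G j a /\ G j b /\
     r = fa_add (fa_mul (fa_mul (Xo j a) (Xo j b)) (Xo j a))
                (fa_mul (fa_mul (Xo j b) (Xo j a)) (Xo j b))) \/
  (exists j a b c : 'I_n, uniq [:: a; b; c] /\ G j a /\ G j b /\ G j c /\
     r = fa_add (fa_mul (fa_mul (fa_mul (Xo j a) (Xo j b)) (Xo j c)) (Xo j a))
          (fa_add (fa_mul (fa_mul (fa_mul (Xo j b) (Xo j c)) (Xo j a)) (Xo j b))
                  (fa_mul (fa_mul (fa_mul (Xo j c) (Xo j a)) (Xo j b)) (Xo j c)))).

Definition relations_generated : Prop :=
  forall p : fa (Edge G), kerG p <-> in_ideal listed_rel p.

Definition indep_images (ps : seq (fa (Edge G))) : Prop :=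
  forall cs : seq rat, size cs = size ps ->
    kerG (fa_lincomb cs ps) -> all (fun c => c == 0) cs.

Definition dimEG (d k : nat) : Prop :=
  (exists ps : seq (fa (Edge G)),
     size ps = k /\ all (fa_homog d) ps /\ indep_images ps) /\
  (forall ps : seq (fa (Edge G)),
     size ps = k.+1 -> all (fa_homog d) ps -> ~ indep_images ps).

(* H_G(t) = N(t)/D(t) as formal power series: D(t) * H_G(t) = N(t) *)
Definition hilb_is (N D : {poly int}) : Prop :=
  exists h : nat -> nat, (forall d, dimEG d (h d)) /\
    forall d, \sum_(i < d.+1) (h (d - i)%N)%:Z * D`_i = N`_d.
End Graph.

Definition qint (k : nat) : {poly int} := \sum_(i < k) 'X^i.

(* E_m: path p_1 - ... - p_{m-1} on vertices 0..m-2 (p_i = i-1), plus q = m-1 joined to p_3 = 2 *)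
Definition Eadj (m : nat) (i j : 'I_m) : bool :=
  (((j : nat) == i.+1) && (j < m.-1)%N) || (((i : nat) == 2%N) && ((j : nat) == m.-1)).
Definition Egraph (m : nat) : rel 'I_m := fun i j => Eadj i j || Eadj j i.
Arguments Egraph m : clear implicits.

(* Main.v *)
From Stdlib Require Import NArith.
Require Import Defs.
From HB Require Import structures.
From mathcomp Require Import all_boot all_order all_algebra.
From mathcomp Require Import ring zify.
Set Implicit Arguments. Unset Strict Implicit. Unset Printing Implicit Defensive.
Import Order.TTheory GRing.Theory Num.Theory.
Local Open Scope ring_scope.

(** Number the vertices of the tree so that each [E_m] is obtained from
    [E_(m-1)] by adding one leaf [k], starting from a path on four vertices;
    stage [k] uses the vertices [0..k] and the edge letters [0..k-1].  Let
    [A_k] be the algebra presented by the listed relations.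

    Spanning.  The graded left module [A_k / A_k A_(k-1)^+] is computed by a
    coset enumeration in the style of Todd and Coxeter; it has dimension
    2, 3, 4, 20, 36, 84, 480 for [k = 1..7].  Hence [A_k] is spanned by the
    products [u h] of a basis word [u] of this module and a word [h] of stage
    [k-1].

    Independence.  For a transposition [t], deleting in a word
    [x_e1 ... x_er] the letters [ei] with [s_e1 ... s_e(i-1) (ei) = t] (with
    signs) is a skew derivation that kills the Fomin-Kirillov ideal.  If a word
    [u] of stage [k] moves vertex [k] to [c], then the derivations for the
    transpositions [(c a)] commute with right multiplication by [A_(k-1)], so
    they act on the module above.  No nonzero element of
    positive degree of the module is killed by all of them, whence the products
    [u h] are independent in the Fomin-Kirillov algebra, by induction on [k].

    So the listed relations are complete, and the Hilbert series is the product
    of those of the modules. *)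

(** * Linear functionals on formal combinations *)

Section Lin.
Variable T : Type.
Implicit Types (g : T -> rat) (p q : seq (rat * T)).

Definition lin g p : rat := \sum_(t <- p) t.1 * g t.2.

Lemma lin_nil g : lin g [::] = 0.
Proof. exact: big_nil. Qed.

Lemma lin_cons g t p : lin g (t :: p) = t.1 * g t.2 + lin g p.
Proof. exact: big_cons. Qed.

Lemma lin_cat g p q : lin g (p ++ q) = lin g p + lin g q.
Proof. exact: big_cat. Qed.

Lemma lin_flatten g ps : lin g (flatten ps) = \sum_(p <- ps) lin g p.
Proof. exact: big_flatten. Qed.

Lemma eq_lin g1 g2 p : g1 =1 g2 -> lin g1 p = lin g2 p.
Proof. by move=> e; apply: eq_bigr => t _; rewrite e. Qed.

Lemma linZr c g p : lin (fun w => g w * c) p = lin g p * c.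
Proof. by rewrite /lin mulr_suml; apply: eq_bigr => t _; rewrite mulrA. Qed.

Lemma linD g1 g2 p : lin (fun w => g1 w + g2 w) p = lin g1 p + lin g2 p.
Proof. by rewrite /lin -big_split; apply: eq_bigr => t _; rewrite mulrDr. Qed.

Lemma lin0 p : lin (fun _ => 0) p = 0.
Proof. by apply: big1 => t _; rewrite mulr0. Qed.
End Lin.

Lemma lin_exchange (T U : Type) (G : T -> U -> rat) r s :
  lin (fun w => lin (G w) s) r = lin (fun u => lin (fun w => G w u) r) s.
Proof.
rewrite /lin; under eq_bigr do rewrite mulr_sumr.
rewrite exchange_big; apply: eq_bigr => u _; rewrite mulr_sumr.
by apply: eq_bigr => t _; rewrite mulrCA.
Qed.

Lemma eq_in_lin (T : eqType) (g1 g2 : T -> rat) (p : seq (rat * T)) :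
  (forall t, t \in p -> g1 t.2 = g2 t.2) -> lin g1 p = lin g2 p.
Proof. by move=> e; apply: eq_big_seq => t /e ->. Qed.

Lemma lin_support (T : eqType) (g : T -> rat) (p : seq (rat * T)) (s : seq T) :
  uniq s -> {subset [seq t.2 | t <- p] <= s} ->
  lin g p = \sum_(w <- s) lin (fun x => (x == w)%:R) p * g w.
Proof.
move=> us sub; rewrite /lin.
under [RHS]eq_bigr do rewrite mulr_suml.
rewrite exchange_big big_seq [RHS]big_seq.
apply: eq_bigr => t tp; have ts : t.2 \in s by apply: sub; apply: map_f.
rewrite (bigD1_seq t.2) //= eqxx mulr1 big1 ?addr0 // => w nw.
by rewrite eq_sym (negPf nw) mulr0 mul0r.
Qed.

(** * Free algebra: testing by functionals, spans, two-sided ideals *)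

Section FreeAlgebra.
Variable V : eqType.
Implicit Types (p q : fa V) (g : seq V -> rat).

Lemma lin_scale g c p : lin g (fa_scale c p) = c * lin g p.
Proof. by rewrite /lin big_map mulr_sumr; apply: eq_bigr => t _; rewrite mulrA. Qed.

Lemma lin_add g p q : lin g (fa_add p q) = lin g p + lin g q.
Proof. exact: lin_cat. Qed.

Lemma lin_word g w : lin g (fa_word w) = g w.
Proof. by rewrite /lin big_seq1 mul1r. Qed.

Lemma lin_mul g p q :
  lin g (fa_mul p q) = lin (fun a => lin (fun b => g (a ++ b)) q) p.
Proof.
rewrite /lin big_allpairs_dep; apply: eq_bigr => a _.
by rewrite mulr_sumr; apply: eq_bigr => b _; rewrite mulrA.
Qed.

Lemma lin_lincomb g cs (ps : seq (fa V)) :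
  lin g (fa_lincomb cs ps) = \sum_(t <- zip cs ps) t.1 * lin g t.2.
Proof. by rewrite lin_flatten big_map; apply: eq_bigr => t _; rewrite lin_scale. Qed.

(** Coefficients are values of indicator functionals, and every functional is determined by the
    coefficients over the joint support. Testing against all [g] turns identities in the free
    algebra into rational ones that [ring] can close. *)
Lemma fa_eqP p q : fa_eq p q <-> forall g, lin g p = lin g q.
Proof.
have co w r : fa_coef r w = lin (fun x => (x == w)%:R) r.
  rewrite /fa_coef big_mkcond; apply: eq_bigr => t _.
  by case: eqP => _; rewrite ?mulr1 ?mulr0.
split=> [e g|e w]; last by rewrite !co e.
pose s := undup ([seq t.2 | t <- p] ++ [seq t.2 | t <- q]).
rewrite (@lin_support _ g p s) ?undup_uniq //; last first.
  by move=> w wp; rewrite mem_undup mem_cat wp.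
rewrite (@lin_support _ g q s) ?undup_uniq //; last first.
  by move=> w wp; rewrite mem_undup mem_cat wp orbT.
by apply: eq_bigr => w _; rewrite -!co e.
Qed.

Definition span (G : fa V -> Prop) p : Prop :=
  exists2 L : seq (rat * fa V), (forall t, t \in L -> G t.2) &
    forall g, lin g p = \sum_(t <- L) t.1 * lin g t.2.

Section Span.
Variable G : fa V -> Prop.

Lemma span_ext p q : (forall g, lin g p = lin g q) -> span G p -> span G q.
Proof. by move=> e [L GL eL]; exists L => // g; rewrite -e eL. Qed.

Lemma span_gen p : G p -> span G p.
Proof.
move=> Gp; exists [:: (1, p)] => [t|g]; first by rewrite inE => /eqP->.
by rewrite big_seq1 mul1r.
Qed.

Lemma span0 p : (forall g, lin g p = 0) -> span G p.
Proof. by move=> e; exists [::] => // g; rewrite e big_nil. Qed.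

Lemma span_scale c p : span G p -> span G (fa_scale c p).
Proof.
move=> [L GL eL]; exists [seq (c * t.1, t.2) | t <- L] => [_ /mapP[t tL ->]|g].
  exact: (GL t).
by rewrite lin_scale eL big_map mulr_sumr; apply: eq_bigr => t _; rewrite mulrA.
Qed.

Lemma span_add p q : span G p -> span G q -> span G (fa_add p q).
Proof.
move=> [L GL eL] [M GM eM]; exists (L ++ M) => [t|g].
  by rewrite mem_cat => /orP[/GL|/GM].
by rewrite lin_add eL eM big_cat.
Qed.

Lemma span_sum (I : eqType) (r : seq I) (c : I -> rat) (f : I -> fa V) p :
  (forall i, i \in r -> span G (f i)) ->
  (forall g, lin g p = \sum_(i <- r) c i * lin g (f i)) -> span G p.
Proof.
move=> sf e.
suff {e} : span G (flatten [seq fa_scale (c i) (f i) | i <- r]).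
  apply: span_ext => g; rewrite e lin_flatten big_map.
  by apply: eq_bigr => i _; rewrite lin_scale.
elim: r sf => [|i r IH] sf /=; first by apply: span0 => g; rewrite lin_nil.
apply: span_add; first by apply/span_scale/sf/mem_head.
by apply: IH => j jr; apply: sf; rewrite inE jr orbT.
Qed.
End Span.

Lemma span_bind (G G' : fa V -> Prop) (f : seq V -> seq V) p q :
  (forall x y, G x -> (forall g, lin g y = lin (fun w => g (f w)) x) -> span G' y) ->
  (forall g, lin g q = lin (fun w => g (f w)) p) -> span G p -> span G' q.
Proof.
move=> GG' e [L GL eL].
pose F (t : rat * fa V) : fa V := [seq (u.1, f u.2) | u <- t.2].
have linF g t : lin g (F t) = lin (fun w => g (f w)) t.2.
  by rewrite /lin big_map.
apply: (@span_sum _ _ L fst F) => [t tL|g].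
  by apply: (GG' t.2) => //; apply: GL.
by rewrite e eL; apply: eq_bigr => t _; rewrite linF.
Qed.

Lemma span_sub (G G' : fa V -> Prop) p :
  (forall x, G x -> span G' x) -> span G p -> span G' p.
Proof.
move=> GG' [L GL eL]; apply: (@span_sum _ _ L fst snd) => // t /GL.
exact: GG'.
Qed.

Definition sandwich (S : fa V -> Prop) p : Prop :=
  exists a b r, S r /\ p = fa_mul (fa_word a) (fa_mul r (fa_word b)).

Lemma lin_sandwich g a b (r : fa V) :
  lin g (fa_mul (fa_word a) (fa_mul r (fa_word b))) =
  lin (fun w => g (a ++ w ++ b)) r.
Proof.
rewrite lin_mul lin_word lin_mul; apply: eq_lin => w.
by rewrite lin_word.
Qed.

Lemma in_idealE (S : fa V -> Prop) p : in_ideal S p <-> span (sandwich S) p.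
Proof.
split=> [[L [SL /fa_eqP eL]]|[L GL eL]].
  pose f (t : rat * seq V * fa V * seq V) :=
    fa_mul (fa_word t.1.1.2) (fa_mul t.1.2 (fa_word t.2)).
  apply: (@span_sum _ _ L (fun t => t.1.1.1) f) => [t tL|g].
    by apply: span_gen; exists t.1.1.2, t.2, t.1.2; split=> //; apply: SL.
  by rewrite eL lin_flatten big_map; apply: eq_bigr => t _; rewrite lin_scale.
elim: L p GL eL => [|t L IH] p GL eL.
  by exists [::]; split=> //; apply/fa_eqP => g; rewrite eL big_nil lin_nil.
have [t' t'L|g|M [SM /fa_eqP eM]] := IH (flatten [seq fa_scale t.1 t.2 | t <- L]).
- by apply: GL; rewrite inE t'L orbT.
- by rewrite lin_flatten big_map; apply: eq_bigr => i _; rewrite lin_scale.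
have [a [b [r [Sr tE]]]] := GL t (mem_head _ _).
exists ((t.1, a, r, b) :: M); split=> [u|].
  by rewrite inE => /orP[/eqP->//|/SM].
apply/fa_eqP => g; rewrite eL big_cons /= lin_cat -eM lin_scale -tE.
congr (_ + _); rewrite lin_flatten big_map.
by apply: eq_bigr => i _; rewrite lin_scale.
Qed.

Lemma in_ideal_mul (S : fa V -> Prop) a b p q :
  (forall g, lin g q = lin (fun w => g (a ++ w ++ b)) p) ->
  in_ideal S p -> in_ideal S q.
Proof.
move=> e /in_idealE sp; apply/in_idealE; apply: span_bind e sp.
move=> x y [a' [b' [r [Sr ->]]]] e.
apply: (@span_ext _ (fa_mul (fa_word (a ++ a')) (fa_mul r (fa_word (b' ++ b))))).
  by move=> g; rewrite e !lin_sandwich; apply: eq_lin => w; rewrite !catA.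
by apply: span_gen; exists (a ++ a'), (b' ++ b), r.
Qed.
End FreeAlgebra.

Lemma lin_map (U V : eqType) (f : U -> V) g (p : fa U) :
  lin g (fa_map f p) = lin (fun w => g (map f w)) p.
Proof. by rewrite /lin big_map. Qed.

Lemma in_ideal_map (U V : eqType) (f : U -> V) (S : fa U -> Prop) (S' : fa V -> Prop) p :
  (forall r, S r -> in_ideal S' (fa_map f r)) ->
  in_ideal S p -> in_ideal S' (fa_map f p).
Proof.
move=> SS' /in_idealE [L GL eL]; apply/in_idealE.
apply: (@span_sum _ _ _ L fst (fun t => fa_map f t.2)) => [t /GL[a [b [r [Sr ->]]]]|g].
  apply/in_idealE; apply: (in_ideal_mul (a := map f a) (b := map f b)) (SS' _ Sr) => g.
  rewrite !lin_map lin_sandwich; apply: eq_lin => w.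
  by rewrite !map_cat.
by rewrite lin_map eL; apply: eq_bigr => t _; rewrite lin_map.
Qed.

(** * The pairing with sequences of transpositions *)

(* [swap e] is the transposition of the two ends of the ordered pair [e]; an
   ordered pair [(i, j)] also stands for the generator [x_ij]. *)
Definition swap (e : nat * nat) (x : nat) : nat :=
  if x == e.1 then e.2 else if x == e.2 then e.1 else x.

(** The value on [x_e] of the derivation along [t], that is, the sign relating [x_e] and [x_t].
    Taking a difference makes it vanish on diagonal pairs as well. *)
Definition sgn (t e : nat * nat) : int := (t == e)%:Z - (t == (e.2, e.1))%:Z.

Definition conj (e t : nat * nat) : nat * nat := (swap e t.1, swap e t.2).

(* The skew derivation along [t]; passing a letter [e] conjugates [t] by [e]. *)
Fixpoint skew (t : nat * nat) (w : seq (nat * nat)) : fa (nat * nat)%type :=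
  if w is e :: w' then
    ((sgn t e)%:~R, w') :: [seq (s.1, e :: s.2) | s <- skew (conj e t) w']
  else [::].

(** For fixed [D], the functional that applies the derivations along [D] in turn and reads off the
    constant term. It descends to the Fomin-Kirillov algebra, and independence is tested with such
    functionals only. *)
Fixpoint pairing (D w : seq (nat * nat)) : rat :=
  if D is t :: D' then lin (pairing D') (skew t w) else (w == [::])%:R.

Lemma swapK e : involutive (swap e).
Proof.
move=> x; rewrite /swap.
case: (eqVneq x e.1) => [->|n1].
  by case: (eqVneq e.2 e.1) => [->//|_]; rewrite eqxx.
case: (eqVneq x e.2) => [->|n2]; first by rewrite eqxx.
by rewrite (negPf n1) (negPf n2).
Qed.

Lemma conjK e : involutive (conj e).
Proof. by case=> x y; rewrite /conj /= !swapK. Qed.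

Lemma sgnN t x y : sgn t (y, x) = - sgn t (x, y).
Proof. by rewrite /sgn opprB. Qed.

Lemma sgn_conj e t f : sgn (conj e t) f = sgn t (conj e f).
Proof.
have H x : (conj e t == x) = (t == conj e x).
  by rewrite -(inj_eq (can_inj (conjK e))) conjK.
by rewrite /sgn !H.
Qed.

Lemma lin_skew_cons g t e w :
  lin g (skew t (e :: w)) =
  (sgn t e)%:~R * g w + lin (fun w' => g (e :: w')) (skew (conj e t) w).
Proof. by rewrite /= lin_cons /= /lin big_map. Qed.

Lemma lin_skew_cat g t u v :
  lin g (skew t (u ++ v)) =
  lin (fun u' => g (u' ++ v)) (skew t u) +
  lin (fun v' => g (u ++ v')) (skew (foldl (fun t e => conj e t) t u) v).
Proof.
elim: u t g => [|e u IH] t g; first by rewrite /= lin_nil add0r.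
by rewrite cat_cons !lin_skew_cons IH addrA.
Qed.

Definition null (r : fa (nat * nat)%type) : Prop :=
  forall D a b, lin (fun w => pairing D (a ++ w ++ b)) r = 0.

(** By the Leibniz rule a derivation of [a r b] has three parts. Deleting in [a] or in [b] leaves
    [r] intact, and induction on [D] applies; for [b] this needs all words of [r] to conjugate [t]
    alike. Deleting in [r] gives zero by hypothesis. *)
Lemma null_skew (r : fa (nat * nat)%type) :
  (forall s, s \in r -> s.2 != [::]) ->
  (forall s s', s \in r -> s' \in r -> forall t,
     foldl (fun t e => conj e t) t s.2 = foldl (fun t e => conj e t) t s'.2) ->
  (forall t g, lin (fun w => lin g (skew t w)) r = 0) -> null r.
Proof.
move=> ne same sk; elim=> [|t D IH] a b.
  (* With no derivation left, only the empty word pairs to a nonzero value. *)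
  rewrite -[RHS](lin0 r); apply: eq_in_lin => s /ne /=.
  by case: a b s => [|? ?] [|? ?] [? []].
pose c s t := foldl (fun t e => conj e t) t (a ++ s).
have e w : pairing (t :: D) (a ++ w ++ b) =
   lin (fun a' => pairing D (a' ++ w ++ b)) (skew t a) +
  (lin (fun w' => pairing D (a ++ w' ++ b)) (skew (c [::] t) w) +
   lin (fun b' => pairing D (a ++ w ++ b')) (skew (c w t) b)).
  by rewrite /= !lin_skew_cat /c cats0 foldl_cat.
rewrite (eq_lin _ e) !linD sk add0r.
have -> : lin (fun w => lin (fun a' => pairing D (a' ++ w ++ b)) (skew t a)) r = 0.
  by rewrite lin_exchange -[RHS](lin0 (skew t a)); apply: eq_lin => u; exact: IH.
rewrite add0r.
case: r ne same {sk} IH => [|s0 r] ne same IH; first by rewrite lin_nil.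
(* The conjugate of [t] past [a w] is the same for all words [w] of [r], so the word [s0] stands for
   all of them. *)
have -> : lin (fun w => lin (fun b' => pairing D (a ++ w ++ b')) (skew (c w t) b)) (s0 :: r)
   = lin (fun w => lin (fun b' => pairing D (a ++ w ++ b')) (skew (c s0.2 t) b)) (s0 :: r).
  apply: eq_in_lin => s sr; rewrite /c !foldl_cat.
  by rewrite (same s s0) ?mem_head.
by rewrite lin_exchange -[RHS](lin0 (skew (c s0.2 t) b)); apply: eq_lin => u; exact: IH.
Qed.

Lemma lin_skew1 g t e : lin g (skew t [:: e]) = (sgn t e)%:~R * g [::].
Proof. by rewrite lin_skew_cons /= lin_nil addr0. Qed.

Lemma lin_skew2 g t e f : lin g (skew t [:: e; f]) =
  (sgn t e)%:~R * g [:: f] + (sgn t (conj e f))%:~R * g [:: e].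
Proof. by rewrite !lin_skew_cons /= lin_nil addr0 sgn_conj. Qed.

Arguments skew : simpl never.

Section FKNull.
Variables i j k l : nat.

Lemma null_diag : null (fa_word [:: (i, i)]).
Proof.
apply: null_skew => [s|s s'|t g].
- by rewrite inE => /eqP->.
- by rewrite !inE => /eqP-> /eqP->.
by rewrite lin_word lin_skew1 /sgn subrr mul0r.
Qed.

Lemma null_opp : null (fa_add (fa_word [:: (i, j)]) (fa_word [:: (j, i)])).
Proof.
apply: null_skew => [s|s s'|t g].
- by rewrite !inE => /orP[] /eqP->.
- have e t : conj (i, j) t = conj (j, i) t.
    by rewrite /conj /swap /=; congr (_, _); do !case: eqP => //; congruence.
  by rewrite !inE => /orP[] /eqP-> /orP[] /eqP-> t //=.
rewrite lin_add !lin_word !lin_skew1 sgnN; ring.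
Qed.

Lemma null_square : i != j -> null (fa_word [:: (i, j); (i, j)]).
Proof.
move=> ij; apply: null_skew => [s|s s'|t g].
- by rewrite inE => /eqP->.
- by rewrite !inE => /eqP-> /eqP->.
rewrite lin_word lin_skew2 /conj /swap /= !eqxx (negPf (_ : j != i)) 1?eq_sym //.
rewrite sgnN; ring.
Qed.

Lemma null_comm : uniq [:: i; j; k; l] ->
  null (fa_add (fa_word [:: (i, j); (k, l)]) (fa_opp (fa_word [:: (k, l); (i, j)]))).
Proof.
rewrite /= !inE !negb_or => /and4P[/and3P[/negPf ij /negPf ik /negPf il] /andP[/negPf jk /negPf jl] /negPf kl _].
have [ki li kj lj] : [/\ (k == i) = false, (l == i) = false, (k == j) = false & (l == j) = false].
  by split; rewrite eq_sym.
have [ji lk] : (j == i) = false /\ (l == k) = false by split; rewrite eq_sym.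
pose E := (ij, ik, il, jk, jl, kl, ji, ki, li, kj, lj, lk, eqxx).
have cm x : swap (k, l) (swap (i, j) x) = swap (i, j) (swap (k, l) x).
  rewrite /swap /=.
  case: (eqVneq x i) => [e|/negPf xi]; first by rewrite ?e !E.
  case: (eqVneq x j) => [e|/negPf xj]; first by rewrite ?e !E.
  case: (eqVneq x k) => [e|/negPf xk]; first by rewrite ?e !E.
  case: (eqVneq x l) => [e|/negPf xl]; first by rewrite ?e !E.
  by rewrite xi xj.
apply: null_skew => [s|s s'|t g].
- by rewrite !inE => /orP[] /eqP->.
- by rewrite !inE => /orP[] /eqP-> /orP[] /eqP-> t //=; rewrite /conj /= !cm.
rewrite !lin_cons !lin_nil /= !sgn_conj /conj /swap /=.
by rewrite ki kj li lj ik il jk jl; ring.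
Qed.

Lemma null_triangle : uniq [:: i; j; k] ->
  null (fa_add (fa_word [:: (i, j); (j, k)])
         (fa_add (fa_word [:: (j, k); (k, i)]) (fa_word [:: (k, i); (i, j)]))).
Proof.
rewrite /= !inE !negb_or => /and3P[/andP[/negPf ij /negPf ik] /negPf jk _].
have [ji ki kj] : [/\ (j == i) = false, (k == i) = false & (k == j) = false].
  by split; rewrite eq_sym.
pose E := (ij, ik, jk, ji, ki, kj, eqxx).
(* The three words of the relation give the same 3-cycle. *)
have e x : swap (j, k) (swap (i, j) x) = swap (k, i) (swap (j, k) x) /\
           swap (j, k) (swap (i, j) x) = swap (i, j) (swap (k, i) x).
  rewrite /swap /=.
  case: (eqVneq x i) => [e|/negPf xi]; first by rewrite ?e !E.
  case: (eqVneq x j) => [e|/negPf xj]; first by rewrite ?e !E.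
  case: (eqVneq x k) => [e|/negPf xk]; first by rewrite ?e !E.
  by rewrite xi xj xk.
apply: null_skew => [s|s s'|t g].
- by rewrite !inE => /or3P[] /eqP->.
- by rewrite !inE => /or3P[] /eqP-> /or3P[] /eqP-> t //=; rewrite /conj /=;
    rewrite ?(e _).2 ?(e _).1 // -?(e _).2 -?(e _).1.
rewrite !lin_cons !lin_nil /= !sgn_conj /conj /swap /= ?eqxx ?(ji, ki, kj, ij, ik, jk, eqxx).
rewrite (sgnN t i j) (sgnN t j k) (sgnN t k i); ring.
Qed.
End FKNull.

Lemma in_ideal_FK_pairing n (nu : 'I_n -> nat) p D :
  injective nu -> in_ideal (@FK_rel n) p ->
  lin (fun w => pairing D [seq (nu e.1, nu e.2) | e <- w]) p = 0.
Proof.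
move=> inj /in_idealE[L GL ->].
pose f (w : seq (FKgen n)) := [seq (nu e.1, nu e.2) | e <- w].
suff nul r : @FK_rel n r -> null (fa_map (fun e : FKgen n => (nu e.1, nu e.2)) r).
  rewrite big_seq big1 // => t /GL[a [b [r [/nul nr ->]]]].
  rewrite lin_sandwich -[RHS](mulr0 t.1) -(nr D (f a) (f b)) lin_map.
  by congr (_ * _); apply: eq_lin => w; rewrite !map_cat.
have U (s : seq 'I_n) : uniq s -> uniq (map nu s) by rewrite map_inj_uniq.
case=> [[i ->]|[[i [j [ij ->]]]|[[i [j [ij ->]]]|[[i [j [k' [l [u ->]]]]]|[i [j [k' [u ->]]]]]]]].
- exact: null_diag.
- exact: null_opp.
- by rewrite /fa_map /= mulr1; apply: null_square; rewrite (inj_eq inj).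
- have := null_comm (U _ u); by rewrite /fa_map /fa_mul /fa_add /fa_opp /fa_scale /= !mulr1.
- have := null_triangle (U _ u); by rewrite /fa_map /fa_mul /fa_add /= !mulr1.
Qed.

(** Certificate form of ideal membership: the entries of [L] are a coefficient, a left word, an
    element already known to be in the ideal, and a right word. *)
Lemma in_ideal_comb (V : eqType) (S : fa V -> Prop) p
    (L : seq (rat * seq V * fa V * seq V)) :
  foldr (fun t P => in_ideal S t.1.2 /\ P) True L ->
  (forall g, lin g p = \sum_(t <- L)
     t.1.1.1 * lin (fun w => g (t.1.1.2 ++ w ++ t.2)) t.1.2) ->
  in_ideal S p.
Proof.
move=> SL e; apply/in_idealE.
have {}SL t : t \in L -> in_ideal S t.1.2.
  elim: {e} L SL => //= u L IH [Su SL].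
  by rewrite inE => /orP[/eqP-> //|]; apply: IH.
apply: (@span_sum _ _ _ L (fun t => t.1.1.1)
  (fun t => fa_mul (fa_word t.1.1.2) (fa_mul t.1.2 (fa_word t.2)))) => [t tL|g].
  apply/in_idealE; apply: (@in_ideal_mul _ _ t.1.1.2 t.2 t.1.2).
    by move=> g; rewrite lin_sandwich.
  exact: SL.
by rewrite e; apply: eq_bigr => t _; rewrite lin_sandwich.
Qed.

Lemma in_ideal_gen (V : eqType) (S : fa V -> Prop) r : S r -> in_ideal S r.
Proof.
move=> Sr; apply/in_idealE; apply: (@span_ext _ _ (fa_mul (fa_word [::]) (fa_mul r (fa_word [::])))).
  by move=> g; rewrite lin_sandwich; apply: eq_lin => w; rewrite cats0.
by apply: span_gen; exists [::], [::], r.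
Qed.

Lemma in_ideal_ext (V : eqType) (S : fa V -> Prop) p q :
  (forall g, lin g p = lin g q) -> in_ideal S p -> in_ideal S q.
Proof. by move=> e /in_idealE sp; apply/in_idealE; apply: span_ext e sp. Qed.

Ltac lin_ring :=
  let g := fresh "g" in
  move=> g; rewrite ?big_cons ?big_nil ?lin_cons ?lin_nil /= ?lin_cons ?lin_nil /=; ring.

(** * The listed relations hold in the Fomin-Kirillov algebra *)

Section ListedInFK.
Variable n : nat.
Local Notation Z := (in_ideal (@FK_rel n)).
Implicit Types (A B C : rat * FKgen n) (j a b c : 'I_n).

(** Edges are stored with one fixed orientation, so [X_ja] is a letter up to sign; carrying the sign
    in [s] treats all orientations at once. *)
Definition oriented j a (s : rat * FKgen n) : Prop :=
  s = (1, (j, a)) \/ s = (-1, (a, j)).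

Lemma oriented_opp j a A : j != a -> oriented j a A ->
  Z [:: (A.1, [:: A.2]); (1, [:: (a, j)])] /\
  Z [:: (A.1, [:: A.2]); (-1, [:: (j, a)])].
Proof.
move=> ja.
have op : Z (fa_add (xFK j a) (xFK a j)).
  by apply: in_ideal_gen; right; left; exists j, a.
case=> -> /=; split.
- exact: op.
- by apply: (@in_ideal_comb _ _ _ [::]); last lin_ring.
- by apply: (@in_ideal_comb _ _ _ [::]); last lin_ring.
- by apply: (@in_ideal_comb _ _ _ [:: (-1, [::], fa_add (xFK j a) (xFK a j), [::])]); last lin_ring.
Qed.

Lemma oriented_square j a A : j != a -> oriented j a A ->
  Z [:: (1, [:: A.2; A.2])].
Proof.
move=> ja [] -> /=; apply: in_ideal_gen; right; right; left.
  by exists j, a; split=> //; rewrite /fa_mul /= mulr1.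
by exists a, j; rewrite eq_sym; split=> //; rewrite /fa_mul /= mulr1.
Qed.

Lemma oriented_comm j c C (b a : 'I_n) : uniq [:: j; c; b; a] -> oriented j c C ->
  Z [:: (1, [:: C.2; (b, a)]); (-1, [:: (b, a); C.2])].
Proof.
move=> u [] -> /=; apply: in_ideal_gen; do 3 right; left.
  by exists j, c, b, a; split=> //; rewrite /fa_mul /fa_add /fa_opp /fa_scale /= !mulr1.
exists c, j, b, a; split; last by rewrite /fa_mul /fa_add /fa_opp /fa_scale /= !mulr1.
move: u; rewrite /= !inE !negb_or => /and4P[/and3P[a1 a2 a3] /andP[a4 a5] a6 _].
by rewrite (eq_sym c j) a1 a2 a3 a4 a5 a6.
Qed.

(** With [A], [B], [y] standing for [x_ja], [x_jc], [x_ca], this is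
    [x_aj x_jc + x_jc x_ca + x_ca x_aj] after replacing [x_aj] by [- A]. *)
Definition triangle A B (y : FKgen n) : fa (FKgen n) :=
  [:: (- (A.1 * B.1), [:: A.2; B.2]); (B.1, [:: B.2; y]); (- A.1, [:: y; A.2])].

Lemma oriented_triangle j a c A C : uniq [:: j; a; c] ->
  oriented j a A -> oriented j c C -> Z (triangle A C (c, a)).
Proof.
move=> u oA oC; move: (u); rewrite /= !inE negb_or andbT => /andP[/andP[ja jc] ac].
have [DA _] := oriented_opp ja oA; have [_ DC] := oriented_opp jc oC.
pose r1 := fa_add (fa_mul (xFK a j) (xFK j c))
   (fa_add (fa_mul (xFK j c) (xFK c a)) (fa_mul (xFK c a) (xFK a j))).
have Z1 : Z r1.
  apply: in_ideal_gen; do 4 right; exists a, j, c; split=> //.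
  by rewrite /= !inE negb_or eq_sym ja ac jc.
apply: (@in_ideal_comb _ _ _ [:: (1, [::], r1, [::]);
  (- C.1, [::], [:: (A.1, [:: A.2]); (1, [:: (a, j)])], [:: C.2]);
  (1, [:: (a, j)], [:: (C.1, [:: C.2]); (-1, [:: (j, c)])], [::]);
  (1, [::], [:: (C.1, [:: C.2]); (-1, [:: (j, c)])], [:: (c, a)]);
  (- 1, [:: (c, a)], [:: (A.1, [:: A.2]); (1, [:: (a, j)])], [::])]).
  by [].
rewrite /r1; lin_ring.
Qed.

(** Multiply the relation [- A B + B y - y A] by [A] on the right and by [B] on the left: the terms
    [B y A] cancel in the sum, and [y A A] and [B B y] vanish by the square relations. *)
Lemma oriented_braid j a b A B : uniq [:: j; a; b] ->
  oriented j a A -> oriented j b B ->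
  Z [:: (A.1 * B.1 * A.1, [:: A.2; B.2; A.2]); (B.1 * A.1 * B.1, [:: B.2; A.2; B.2])].
Proof.
move=> u oA oB; move: (u); rewrite /= !inE negb_or andbT => /andP[/andP[ja jb] ab].
have tAB := oriented_triangle u oA oB.
have [AA BB] := (oriented_square ja oA, oriented_square jb oB).
apply: (@in_ideal_comb _ _ _ [:: (- A.1, [::], triangle A B (b, a), [:: A.2]);
  (- B.1, [:: B.2], triangle A B (b, a), [::]);
  (- A.1 ^+ 2, [:: (b, a)], [:: (1, [:: A.2; A.2])], [::]);
  (B.1 ^+ 2, [::], [:: (1, [:: B.2; B.2])], [:: (b, a)])]).
  by [].
rewrite /triangle; lin_ring.
Qed.

(** The certificate passes through the third sides of the triangles at [j], which are letters
    outside the claw, and uses that [C] commutes with [x_ba]. *)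
Lemma oriented_claw j a b c A B C : uniq [:: j; a; b; c] ->
  oriented j a A -> oriented j b B -> oriented j c C ->
  Z [:: (A.1 * B.1 * C.1 * A.1, [:: A.2; B.2; C.2; A.2]);
        (B.1 * C.1 * A.1 * B.1, [:: B.2; C.2; A.2; B.2]);
        (C.1 * A.1 * B.1 * C.1, [:: C.2; A.2; B.2; C.2])].
Proof.
rewrite /= !inE !negb_or => /and4P[/and3P[ja jb jc] /andP[ab ac] bc _] oA oB oC.
have tAC : Z (triangle A C (c, a)).
  by apply: oriented_triangle oA oC; rewrite /= !inE negb_or ja jc ac.
have tAB : Z (triangle A B (b, a)).
  by apply: oriented_triangle oA oB; rewrite /= !inE negb_or ja jb ab.
have tCB : Z (triangle C B (b, c)).
  by apply: oriented_triangle oC oB; rewrite /= !inE negb_or jc jb eq_sym bc.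
have CY : Z [:: (1, [:: C.2; (b, a)]); (-1, [:: (b, a); C.2])].
  apply: oriented_comm oC; rewrite /= !inE !negb_or.
  by rewrite jc jb ja !(eq_sym c) !(eq_sym b a) bc ac ab.
have AA := oriented_square ja oA; have BB := oriented_square jb oB.
have CC := oriented_square jc oC.
pose cy : fa (FKgen n) := [:: (1, [:: C.2; (b, a)]); (-1, [:: (b, a); C.2])].
(* found by linear algebra in degree 4 *)
apply: (@in_ideal_comb _ _ _ [::
  (A.1, [:: (b, a)], triangle A C (c, a), [:: A.2]);
  (A.1 ^+ 2, [:: (b, a); (c, a)], [:: (1, [:: A.2; A.2])], [::]);
  (C.1, [:: (b, a); C.2], triangle A C (c, a), [::]);
  (- C.1 ^+ 2, [:: (b, a)], [:: (1, [:: C.2; C.2])], [:: (c, a)]);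
  (- (C.1 * A.1 * C.1), [::], cy, [:: A.2; C.2]);
  (- (C.1 * A.1), [::], triangle A B (b, a), [:: C.2; A.2]);
  (- C.1 ^+ 2, [:: C.2], triangle A B (b, a), [:: C.2]);
  (- C.1 ^+ 2, [:: (b, c)], [:: (1, [:: C.2; C.2])], [:: (b, a)]);
  (- (C.1 * B.1 * C.1), [:: C.2; B.2], cy, [::]);
  (- C.1, [::], triangle C B (b, c), [:: C.2; (b, a)]);
  (- B.1, [:: B.2], triangle C B (b, c), [:: (b, a)]);
  (- (B.1 * C.1 * A.1), [:: B.2], cy, [:: A.2]);
  (- (B.1 * C.1), [:: B.2; C.2], triangle A B (b, a), [::]);
  (B.1 ^+ 2, [::], [:: (1, [:: B.2; B.2])], [:: (b, c); (b, a)])]).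
  by rewrite /cy.
rewrite /cy /triangle; lin_ring.
Qed.
End ListedInFK.

(** * The listed relations between the edge generators of a graph *)

Section Graph.
Variables (n : nat) (G : rel 'I_n).
Hypotheses (Gsym : symmetric G) (Girr : irreflexive G).
Implicit Types (e f : Edge G) (j a b c : 'I_n).

Lemma edge_lt e : ((val e).1 < (val e).2)%N.
Proof. by case/andP: (valP e). Qed.

Lemma edge_adj e : G (val e).1 (val e).2.
Proof. by case/andP: (valP e). Qed.

Lemma Xo_edge e : Xo G (val e).1 (val e).2 = fa_word [:: e].
Proof.
rewrite /Xo edge_lt.
case: insubP => [e' _ ve|]; last by rewrite edge_lt edge_adj.
rewrite (_ : e' = e) //; apply: val_inj; by rewrite ve -surjective_pairing.
Qed.

Lemma Xo_edgeN e : Xo G (val e).2 (val e).1 = fa_opp (fa_word [:: e]).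
Proof.
rewrite /Xo ltnNge ltnW ?edge_lt //=.
case: insubP => [e' _ ve|]; last by rewrite edge_lt edge_adj.
rewrite (_ : e' = e) //; apply: val_inj; by rewrite ve -surjective_pairing.
Qed.

Lemma adj_edge j a : G j a -> exists e, val e = (j, a) \/ val e = (a, j).
Proof.
move=> ja; have nja : j != a by apply: contraTneq ja => ->; rewrite Girr.
have [lt|ge] := ltnP j a.
  have P : ((j, a).1 < (j, a).2)%N && G (j, a).1 (j, a).2 by rewrite lt ja.
  by exists (exist _ (j, a) P); left.
have P : ((a, j).1 < (a, j).2)%N && G (a, j).1 (a, j).2.
  by rewrite /= Gsym ja ltn_neqAle ge eq_sym nja.
by exists (exist _ (a, j) P); right.
Qed.

Lemma Xo_oriented j a : G j a -> exists s : rat * Edge G,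
  Xo G j a = [:: (s.1, [:: s.2])] /\ oriented j a (s.1, val s.2).
Proof.
case/adj_edge=> e [ve|ve].
  exists (1, e); have := Xo_edge e; rewrite ve /= => ->.
  by split=> //; left; rewrite -ve.
exists (-1, e); have := Xo_edgeN e; rewrite ve /= => ->.
by split; [rewrite /fa_opp /fa_scale /= mulr1 | right; rewrite -ve].
Qed.

Lemma kerG_listed p : in_ideal (@listed_rel n G) p -> kerG p.
Proof.
apply: in_ideal_map => r.
have irr j a : G j a -> j != a by move=> ja; apply: contraTneq ja => ->; rewrite Girr.
case=> [[e ->]|[[e [f [ef ->]]]|[[j [a [b [ab [ja [jb ->]]]]]]|
  [j [a [b [c [abc [ja [jb [jc ->]]]]]]]]]]].
- rewrite /fa_map /=; have := edge_lt e; rewrite /edge_letter.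
  case: (val e) => i j /= ij; apply: in_ideal_gen; right; right; left.
  by exists i, j; rewrite neq_ltn ij; split=> //; rewrite /fa_mul /= mulr1.
- apply: in_ideal_gen; do 3 right; left; exists (val e).1, (val e).2, (val f).1, (val f).2.
  split=> //; rewrite /fa_map /fa_add /fa_opp /fa_scale /fa_mul /= !mulr1 /edge_letter.
  by rewrite -!surjective_pairing.
- have [A [-> oA]] := Xo_oriented ja; have [B [-> oB]] := Xo_oriented jb.
  have u : uniq [:: j; a; b] by rewrite /= !inE negb_or ab !irr.
  have := oriented_braid u oA oB; apply: in_ideal_ext.
  by move=> g; rewrite lin_map /fa_add /= !lin_cons !lin_nil.
have [A [-> oA]] := Xo_oriented ja; have [B [-> oB]] := Xo_oriented jb.
have [C [-> oC]] := Xo_oriented jc.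
have u : uniq [:: j; a; b; c] by rewrite cons_uniq abc !inE !negb_or !irr.
have := oriented_claw u oA oB oC; apply: in_ideal_ext.
by move=> g; rewrite lin_map /fa_add /= !lin_cons !lin_nil.
Qed.

Lemma listed_commute e f : edges_disjoint e f ->
  in_ideal (@listed_rel n G) [:: (1, [:: e; f]); (-1, [:: f; e])].
Proof.
move=> ef; apply: in_ideal_gen; right; left; exists e, f; split=> //.
Qed.

Lemma listed_braid_at j a b A B : a != b -> G j a -> G j b ->
  Xo G j a = [:: A] -> Xo G j b = [:: B] ->
  in_ideal (@listed_rel n G)
    [:: (A.1 * B.1 * A.1, A.2 ++ B.2 ++ A.2); (B.1 * A.1 * B.1, B.2 ++ A.2 ++ B.2)].
Proof.
move=> ab ja jb eA eB; apply: in_ideal_gen; do 2 right; left.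
by exists j, a, b; rewrite eA eB /fa_add /= !catA.
Qed.

(** Substituting [X_ja = ± e] and [X_jb = ± f] gives [e f e ± f e f] up to a global sign, the inner
    sign being the product of the two. It is plus exactly when the common vertex has the same place
    in both stored pairs. *)
Lemma listed_braid e f : e != f -> ~~ edges_disjoint e f ->
  let sg := ((val e).1 == (val f).1) || ((val e).2 == (val f).2) in
  in_ideal (@listed_rel n G)
    [:: (1, [:: e; f; e]); (if sg then 1 else -1, [:: f; e; f])].
Proof.
move=> ef nd sg.
have le := edge_lt e; have lf := edge_lt f.
have ge := edge_adj e; have gf := edge_adj f.
have ge' : G (val e).2 (val e).1 by rewrite Gsym.
have gf' : G (val f).2 (val f).1 by rewrite Gsym.
have op e' : fa_opp (fa_word [:: e']) = [:: (-1, [:: e'])] :> fa (Edge G).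
  by rewrite /fa_opp /fa_scale /= mulr1.
have XN e' : Xo G (val e').2 (val e').1 = [:: (-1, [:: e'])] by rewrite Xo_edgeN op.
have ne1 : (val e).1 = (val f).1 -> (val e).2 != (val f).2.
  move=> e1; apply: contraNneq ef => e2; apply/eqP/val_inj.
  by rewrite [LHS]surjective_pairing [RHS]surjective_pairing e1 e2.
have [e1|n1] := eqVneq (val e).1 (val f).1.
  rewrite /sg e1 eqxx /=.
  have jf : G (val e).1 (val f).2 by rewrite e1.
  have xf : Xo G (val e).1 (val f).2 = [:: (1, [:: f])] by rewrite e1 Xo_edge.
  have := listed_braid_at (ne1 e1) ge jf (Xo_edge e) xf.
  by apply: in_ideal_ext; rewrite /=; lin_ring.
rewrite /sg (negPf n1) /=.
have [e2|n2] := eqVneq (val e).2 (val f).2.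
  have jf : G (val e).2 (val f).1 by rewrite e2.
  have xf : Xo G (val e).2 (val f).1 = [:: (-1, [:: f])] by rewrite e2 XN.
  have := listed_braid_at n1 ge' jf (XN e) xf.
  move=> /in_idealE/(span_scale (-1))/in_idealE.
  by apply: in_ideal_ext => g; rewrite lin_scale; move: g; lin_ring.
have [e3|n3] := eqVneq (val e).1 (val f).2.
  have jf : G (val e).1 (val f).1 by rewrite e3.
  have xf : Xo G (val e).1 (val f).1 = [:: (-1, [:: f])] by rewrite e3 XN.
  have n4 : (val e).2 != (val f).1.
    by rewrite neq_ltn (ltn_trans lf) ?orbT // -e3.
  have := listed_braid_at n4 ge jf (Xo_edge e) xf.
  move=> /in_idealE/(span_scale (-1))/in_idealE.
  by apply: in_ideal_ext => g; rewrite lin_scale; move: g; lin_ring.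
have e4 : (val e).2 = (val f).1.
  have nle : (val e).1 != (val e).2 by rewrite neq_ltn le.
  have nlf : (val f).1 != (val f).2 by rewrite neq_ltn lf.
  apply: contraNeq nd => n4.
  by rewrite /edges_disjoint /= !inE !negb_or n1 n3 n2 n4 nle nlf.
have jf : G (val e).2 (val f).2 by rewrite e4.
have xf : Xo G (val e).2 (val f).2 = [:: (1, [:: f])] by rewrite e4 Xo_edge.
have := listed_braid_at n3 ge' jf (XN e) xf.
by apply: in_ideal_ext; lin_ring.
Qed.

(** Here [e] points into the centre of the claw and [f], [h] point out of it, so [X_ja = - e] and
    the two terms with a single [e] change sign. The conclusions are the two cyclic orders. *)
Lemma listed_claw e f h : uniq [:: (val e).1; (val f).2; (val h).2] ->
  (val e).2 = (val f).1 -> (val f).1 = (val h).1 ->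
  in_ideal (@listed_rel n G)
    [:: (1, [:: e; f; h; e]); (-1, [:: f; h; e; f]); (-1, [:: h; e; f; h])] /\
  in_ideal (@listed_rel n G)
    [:: (1, [:: e; h; f; e]); (-1, [:: h; f; e; h]); (-1, [:: f; e; h; f])].
Proof.
have H f' h' : uniq [:: (val e).1; (val f').2; (val h').2] ->
  (val e).2 = (val f').1 -> (val f').1 = (val h').1 ->
  in_ideal (@listed_rel n G)
    [:: (1, [:: e; f'; h'; e]); (-1, [:: f'; h'; e; f']); (-1, [:: h'; e; f'; h'])].
  move=> u e1 e2.
  have : in_ideal (@listed_rel n G) (let j := (val e).2 in let a := (val e).1 in
     let b := (val f').2 in let c := (val h').2 in
     fa_add (fa_mul (fa_mul (fa_mul (Xo G j a) (Xo G j b)) (Xo G j c)) (Xo G j a))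
          (fa_add (fa_mul (fa_mul (fa_mul (Xo G j b) (Xo G j c)) (Xo G j a)) (Xo G j b))
                  (fa_mul (fa_mul (fa_mul (Xo G j c) (Xo G j a)) (Xo G j b)) (Xo G j c)))).
    apply: in_ideal_gen; do 3 right.
    exists (val e).2, (val e).1, (val f').2, (val h').2; split=> //.
    by rewrite Gsym edge_adj {1}e1 edge_adj e1 e2 edge_adj.
  rewrite /= Xo_edgeN e1 Xo_edge e2 Xo_edge.
  by apply: in_ideal_ext; rewrite /fa_opp /fa_scale /fa_mul /fa_add /=; lin_ring.
move=> u e1 e2; split; first exact: H.
apply: H; rewrite -?e2 //.
by move: u; rewrite /= !inE !negb_or (eq_sym (val f).2) => /and3P[/andP[-> ->] -> _].
Qed.
End Graph.

(** * Coset enumeration *)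

(* Vertices: [q = 0], [p_3 = 1], [p_2 = 2], [p_1 = 3] and [p_i = i] for [i > 3];
   letter [l] is the edge that joins vertex [l + 1] to the smaller tree, oriented
   as in [Egraph]. *)
Definition ends (e : nat) : nat * nat :=
  nth (0, 0)%N [:: (1, 0); (2, 1); (3, 2); (1, 4); (4, 5); (5, 6); (6, 7)]%N e.

Definition srel := seq (int * seq nat).

Definition square_rel (e : nat) : srel := [:: (1, [:: e; e])].

Definition pair_rel (e f : nat) : srel :=
  let p := ends e in let q := ends f in
  if uniq [:: p.1; p.2; q.1; q.2] then [:: (1, [:: e; f]); (-1, [:: f; e])]
  else [:: (1, [:: e; f; e]);
           (if (p.1 == q.1) || (p.2 == q.2) then 1 else -1, [:: f; e; f])].

Definition claw_rel a b c : srel :=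
  [:: (1, [:: a; b; c; a]); (-1, [:: b; c; a; b]); (-1, [:: c; a; b; c])].

(** The only vertex of degree three is [p_3], with letters 0, 1 and 3. A claw relation is unchanged
    by rotation, so two cyclic orders suffice, from the stage where letter 3 is present. *)
Definition stage_rels (k : nat) : seq srel :=
  [seq square_rel e | e <- iota 0 k] ++
  [seq pair_rel e f | e <- iota 0 k, f <- iota 0 e] ++
  if (3 < k)%N then [:: claw_rel 1 0 3; claw_rel 1 3 0] else [::].

Definition svec := seq (int * nat).

Definition vco (T : eqType) (v : seq (int * T)) (j : T) : int :=
  foldr (fun t s => if t.2 == j then t.1 + s else s) 0 v.

Definition vscale (c : int) (v : svec) : svec := [seq (c * t.1, t.2) | t <- v].

Definition vapp (M : nat -> svec) (v : svec) : svec :=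
  flatten [seq vscale t.1 (M t.2) | t <- v].

Definition vzero (v : svec) : bool := all (fun t => vco v t.2 == 0) v.

(* Degree [d] part of the module.  Basis vector [i] is [x_e] times the basis
   vector [p] of degree [d - 1] for [(e, p) = ltree i]; [lpos i] is the image of
   vertex [k] under its word; [lmul e i] is [x_e] times vector [i], in degree
   [d + 1]; [lskew i a] is the derivation along [(lpos i, a)], in degree [d - 1].
   [lord] lists pairs [(e, i)] with an instance (relation, basis vector) whose
   only product not known before is [x_e] times vector [i]; [lpeel] lists
   [(i, (a, j))] such that coordinate [j] of the derivation towards [a] isolates
   coordinate [i] among those not yet known to vanish. *)
Record level := Level {
  ltree : seq (nat * nat);
  lpos : seq nat;
  lmul : seq (seq svec);
  lord : seq ((nat * nat) * (nat * nat));
  lskew : seq (seq svec);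
  lpeel : seq (nat * (nat * nat)) }.

Definition level0 := Level [::] [::] [::] [::] [::] [::].

Section Tables.
Variable L : seq level.

Definition lev d := nth level0 L d.
Definition dim d := size (ltree (lev d)).
Definition tree d i := nth (0, 0)%N (ltree (lev d)) i.
Definition pos d i := nth 0%N (lpos (lev d)) i.
Definition mulT d e i : svec := nth [::] (nth [::] (lmul (lev d)) e) i.
Definition skewT d i a : svec := nth [::] (nth [::] (lskew (lev d)) i) a.

Fixpoint act d (w : seq nat) (v : svec) : svec :=
  if w is e :: w' then vapp (mulT (d + size w') e) (act d w' v) else v.

(* The relation [r] applied to basis vector [j] of degree [d + 1 - deg r], as a
   combination of the products [x_e * vector i], written [(e, i)]. *)
Definition row d (r : srel) j : seq (int * (nat * nat)) :=
  flatten [seq [seq (t.1 * s.1, (head 0%N t.2, s.2)) |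
     s <- act (d - (size t.2).-1) (behead t.2) [:: (1, j)]] | t <- r].

Section Check.
Variable k : nat.

Definition check_tree d :=
  all (fun i => let p := tree d.+1 i in
    [&& p.1 < k, p.2 < dim d & mulT d p.1 p.2 == [:: (1%R, i)]]%N) (iota 0 (dim d.+1)).

Definition check_pos d :=
  all (fun e => all (fun i => all (fun t =>
     (t.2 < dim d.+1)%N && (pos d.+1 t.2 == swap (ends e) (pos d i)))
       (mulT d e i)) (iota 0 (dim d))) (iota 0 k).

Definition row_sum (rw : seq (int * (nat * nat))) d : svec :=
  flatten [seq vscale t.1 (mulT d t.2.1 t.2.2) | t <- rw].

(** Replays the search: [K] holds the products whose table values are justified. Each step names a
    relation instance in which only [p] may lie outside [K], has a nonzero coefficient, and which
    the table satisfies. *)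
Fixpoint check_order d (K : seq (nat * nat)) (os : seq ((nat * nat) * (nat * nat))) : bool :=
  if os is (p, (r, j)) :: os' then
    let r := nth [::] (stage_rels k) r in
    let rw := row d r j in
    [&& constant [seq size t.2 | t <- r],
        all (fun t => [&& all (gtn k) t.2, t.2 != [::], (size t.2).-1 <= d &
                           j < dim (d - (size t.2).-1)]%N) r,
        all (fun t => (t.2 == p) || (t.2 \in K)) rw, vco rw p != 0,
        vzero (row_sum rw d) & check_order d (p :: K) os']
  else all (fun e => all (fun i => (e, i) \in K) (iota 0 (dim d))) (iota 0 k).

Definition check_skew d :=
  all (fun i => all (fun a => all (fun t =>
     (t.2 < dim d)%N && (pos d t.2 == a)) (skewT d.+1 i a)) (iota 0 k.+1)) (iota 0 (dim d.+1)).

(** The Leibniz rule for the derivation of [x_e] times vector [i] along [(c, a)], which becomes its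
    conjugate past [x_e]. The case [a = c] is left out since it is no transposition; for [d = 0] the
    truncated [d.-1] is harmless because [skewT] is empty there. *)
Definition check_leibniz d :=
  all (fun e => all (fun i => let c := swap (ends e) (pos d i) in all (fun a =>
     (a == c) ||
     vzero (vapp (fun j => skewT d.+1 j a) (mulT d e i) ++ (- sgn (c, a) (ends e), i) ::
        vscale (-1) (vapp (mulT d.-1 e) (skewT d i (swap (ends e) a)))))
   (iota 0 k.+1)) (iota 0 (dim d))) (iota 0 k).

(** Triangular elimination: a vector killed by all derivations loses its coordinates one by one.
    Only vectors with the same image of vertex [k] interact, because the transposition starts at
    that image. *)
Fixpoint check_peel d (Z : seq nat) (zs : seq (nat * (nat * nat))) : bool :=
  if zs is (i, (a, j)) :: zs' then
    [&& (a <= k)%N, a != pos d.+1 i, (j < dim d)%N, pos d j == a, vco (skewT d.+1 i a) j != 0,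
        all (fun i' => [|| i' == i, pos d.+1 i' != pos d.+1 i, i' \in Z |
                        vco (skewT d.+1 i' a) j == 0]) (iota 0 (dim d.+1))
      & check_peel d (i :: Z) zs']
  else all (fun i => i \in Z) (iota 0 (dim d.+1)).

(** In degree 0 the letters below [k.-1] kill the generator, which is the passage to the quotient by
    [A_k A_(k-1)^+]. Their products are known from the start, as are those that define new basis
    vectors. *)
Definition check_level d :=
  [&& check_tree d, check_pos d,
      (d == 0%N) ==> all (fun h => mulT 0 h 0 == [::]) (iota 0 k.-1),
      check_order d (ltree (lev d.+1) ++
        if d == 0%N then [seq (h, 0%N) | h <- iota 0 k.-1] else [::]) (lord (lev d)),
      check_skew d, check_leibniz d & check_peel d [::] (lpeel (lev d.+1))].

Definition check :=
  [&& (0 < k)%N, dim 0 == 1%N, pos 0 0 == k, nilp (lskew (lev 0)) &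
      all check_level (iota 0 (size L))].
End Check.
End Tables.

Definition vnorm (T : eqType) (v : seq (int * T)) : seq (int * T) :=
  [seq t <- [seq (vco v j, j) | j <- undup [seq t.2 | t <- v]] | t.1 != 0].

(* The search below needs no proof: only its output is checked. *)
Section Generate.
Definition values := seq ((nat * nat) * svec).
Definition row_t := (seq (int * (nat * nat)) * (nat * nat))%type.
Definition order_t := seq ((nat * nat) * (nat * nat)).

Definition value (K : values) (p : nat * nat) : svec :=
  head [::] [seq t.2 | t <- K & t.1 == p].

Definition solve (st : values * order_t * seq row_t) (ro : row_t) :=
  let: (K, o, rest) := st in
  match [seq t <- ro.1 | t.2 \notin unzip1 K] with
  | [::] => st
  | [:: (c, p)] =>
     (* Multiplying by [- c] solves for [p] only when [c] is 1 or -1; a wrong value would be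
        rejected by [check]. *)
     ((p, vnorm (flatten [seq vscale (- c * t.1) (value K t.2) | t <- ro.1 & t.2 != p])) :: K,
      (p, ro.2) :: o, rest)
  | _ => (K, o, ro :: rest)
  end.

Fixpoint solve_all fuel (st : values * order_t * seq row_t) :=
  if fuel is f.+1 then
    let: (K, o, rows) := st in
    let st' := foldl solve (K, o, [::]) rows in
    if size st'.1.2 == size o then st' else solve_all f st'
  else st.

(** When no relation instance has a single unknown product left, the first unknown product is
    declared a new basis vector, as in coset enumeration. *)
Fixpoint grow fuel k n (tr : seq (nat * nat)) (st : values * order_t * seq row_t) :=
  if fuel is f.+1 then
    let: (K, o, rows) := solve_all 100 st in
    match [seq p <- [seq (e, i) | e <- iota 0 k, i <- iota 0 n] | p \notin unzip1 K] with
    | [::] => (K, o, tr)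
    | p :: _ => grow f k n (rcons tr p) ((p, [:: (1, size tr)]) :: K, o, rows)
    end
  else (st.1.1, st.1.2, tr).

Definition rows_at (L : seq level) k d : seq row_t :=
  flatten [seq (let l := (size (head (0 : int, [::] : seq nat) rn.1).2).-1 in
     if (l <= d)%N then [seq (vnorm (row L d rn.1 j), (rn.2, j)) | j <- iota 0 (dim L (d - l))]
     else [::]) | rn <- zip (stage_rels k) (iota 0 (size (stage_rels k)))].

Definition peel_pass (L : seq level) k d (Z : seq (nat * (nat * nat))) :=
  foldl (fun Z i =>
    if i \in unzip1 Z then Z else
    let cand := [seq aj <- [seq (a, t.2) | a <- iota 0 k.+1, t <- skewT L d i a] |
       all (fun i' => [|| i' == i, pos L d i' != pos L d i, i' \in unzip1 Z |
            vco (skewT L d i' aj.1) aj.2 == 0]) (iota 0 (dim L d))] in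
    if cand is aj :: _ then rcons Z (i, aj) else Z) Z (iota 0 (dim L d)).

Fixpoint gen fuel k d (L : seq level) : seq level :=
  if fuel is f.+1 then
    let l := lev L d in
    let n := dim L d in
    let K0 := if d == 0%N then [seq ((h, 0%N), [::]) | h <- iota 0 k.-1] else [::] in
    let: (K, o, tr) := grow 100 k n [::] (K0, [::], rows_at L k d) in
    let mt := [seq [seq value K (e, i) | i <- iota 0 n] | e <- iota 0 k] in
    let L := set_nth level0 L d (Level (ltree l) (lpos l) mt (rev o) (lskew l) (lpeel l)) in
    if tr is [::] then L else
    let ps := [seq swap (ends p.1) (pos L d p.2) | p <- tr] in
    let st := [seq (let: (e, p) := tp.1 in let c := tp.2 in
     [seq (if a == c then [::] else
        vnorm ((sgn (c, a) (ends e), p) ::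
               vapp (mulT L d.-1 e) (skewT L d p (swap (ends e) a))))
      | a <- iota 0 k.+1]) | tp <- zip tr ps] in
    let L := rcons L (Level tr ps [::] [::] st [::]) in
    let Z := iter 5 (peel_pass L k d.+1) [::] in
    gen f k d.+1 (set_nth level0 L d.+1 (Level tr ps [::] [::] st Z))
  else L.

Definition generate k := gen 60 k 0 [:: Level [:: (0, 0)%N] [:: k] [::] [::] [::] [::]].
End Generate.

(** The tables are stored as literal data, so that later conversions do not rerun the search. *)
Definition stage1 := Eval vm_compute in generate 1.
Definition stage2 := Eval vm_compute in generate 2.
Definition stage3 := Eval vm_compute in generate 3.
Definition stage4 := Eval vm_compute in generate 4.
Definition stage5 := Eval vm_compute in generate 5.
Definition stage6 := Eval vm_compute in generate 6.
Definition stage7 := Eval vm_compute in generate 7.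

(** * Spanning *)

Section Vectors.
Implicit Types (v : svec) (f : nat -> rat).

Definition vlin f v : rat := \sum_(t <- v) t.1%:~R * f t.2.

Lemma vlin_nil f : vlin f [::] = 0.
Proof. exact: big_nil. Qed.

Lemma vlin_cons f t v : vlin f (t :: v) = t.1%:~R * f t.2 + vlin f v.
Proof. exact: big_cons. Qed.

Lemma vlin_cat f u v : vlin f (u ++ v) = vlin f u + vlin f v.
Proof. exact: big_cat. Qed.

Lemma vlin_scale f c v : vlin f (vscale c v) = c%:~R * vlin f v.
Proof.
rewrite /vlin big_map mulr_sumr; apply: eq_bigr => t _.
by rewrite intrM mulrA.
Qed.

Lemma vlin_app f M v : vlin f (vapp M v) = vlin (fun i => vlin f (M i)) v.
Proof.
rewrite /vlin big_flatten big_map; apply: eq_bigr => t _.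
exact: vlin_scale.
Qed.

Lemma eq_in_vlin f1 f2 v :
  (forall t, t \in v -> f1 t.2 = f2 t.2) -> vlin f1 v = vlin f2 v.
Proof. by move=> e; apply: eq_big_seq => t /e ->. Qed.

Lemma vlin0 v : vlin (fun _ => 0) v = 0.
Proof. by apply: big1 => t _; rewrite mulr0. Qed.

Lemma vcoE (T : eqType) (v : seq (int * T)) j :
  (vco v j)%:~R = \sum_(t <- v | t.2 == j) t.1%:~R :> rat.
Proof.
elim: v => [|t v IH]; first by rewrite big_nil.
by rewrite big_cons /=; case: eqP => _ //; rewrite intrD IH.
Qed.

Lemma vlin_support f v (s : seq nat) :
  uniq s -> {subset [seq t.2 | t <- v] <= s} ->
  vlin f v = \sum_(j <- s) (vco v j)%:~R * f j.
Proof.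
move=> us sub.
pose p : seq (rat * nat) := [seq (t.1%:~R, t.2) | t <- v].
have -> : vlin f v = lin f p by rewrite /lin big_map.
rewrite (@lin_support _ f p s) //; last first.
  by move=> j; rewrite -map_comp; apply: sub.
apply: eq_bigr => j _; congr (_ * _).
rewrite vcoE /lin big_map [RHS]big_mkcond; apply: eq_bigr => t _ /=.
by case: eqP => _; rewrite ?mulr1 ?mulr0.
Qed.

Lemma vlin_vzero f v : vzero v -> vlin f v = 0.
Proof.
move=> /allP z; rewrite (@vlin_support _ _ (undup [seq t.2 | t <- v])) ?undup_uniq //.
  rewrite big_seq big1 // => j; rewrite mem_undup => /mapP[t /z /eqP zt ->].
  by rewrite zt mul0r.
by move=> j jv; rewrite mem_undup.
Qed.
End Vectors.

Lemma linN_vec (T : eqType) (g : T -> rat) (f : nat -> T) (v : svec) :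
  lin g [seq (- t.1%:~R, f t.2) | t <- v] = - vlin (fun j => g (f j)) v.
Proof. by rewrite /lin /vlin big_map -sumrN; apply: eq_bigr => t _; rewrite mulNr. Qed.

Definition relfa (r : srel) : fa nat := [seq (t.1%:~R, t.2) | t <- r].

Definition stage_rel (k : nat) (x : fa nat) : Prop :=
  exists2 r, r \in stage_rels k & x = relfa r.

(** Hence stage [k] stays on the vertices [0..k], and letters below [k.-1] fix vertex [k]. Past the
    seventh letter the default pair [(0, 0)] satisfies the bound. *)
Lemma ends_le e : ((ends e).1 <= e.+1)%N && ((ends e).2 <= e.+1)%N.
Proof. by do 7 (case: e => [|e] //); rewrite /ends nth_default. Qed.

Lemma skewT_nil L d i a : lskew (lev L d) = [::] -> skewT L d i a = [::].
Proof. by rewrite /skewT => ->; rewrite !nth_nil. Qed.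

Lemma dim_default L d : (size L <= d)%N -> dim L d = 0%N.
Proof. by move=> le; rewrite /dim /lev nth_default. Qed.

Section Stage.
Variables (L : seq level) (k : nat).
Hypothesis chk : check L k.
Local Notation dim := (dim L).
Local Notation tree := (tree L).
Local Notation pos := (pos L).
Local Notation mulT := (mulT L).
Local Notation skewT := (skewT L).
Local Notation act := (act L).
Implicit Types (d e i j a : nat) (u w h : seq nat).

Lemma stage_gt0 : (0 < k)%N.
Proof. by case/and5P: chk. Qed.

Lemma dim0 : dim 0 = 1%N.
Proof. by case/and5P: chk => _ /eqP. Qed.

Lemma pos0 : pos 0 0 = k.
Proof. by case/and5P: chk => _ _ /eqP. Qed.

Lemma skewT0 i a : skewT 0 i a = [::].
Proof. by case/and5P: chk => _ _ _ /nilP e _; apply: skewT_nil. Qed.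

Lemma chk_level d : (d < size L)%N -> check_level L k d.
Proof. by case/and5P: chk => _ _ _ _ /allP H dL; apply: H; rewrite mem_iota. Qed.

Lemma dim_lt d i : (i < dim d)%N -> (d < size L)%N.
Proof. by case: (ltnP d (size L)) => // /dim_default->; rewrite ltn0. Qed.

Lemma treeP d i : (i < dim d.+1)%N -> [/\ ((tree d.+1 i).1 < k)%N,
  ((tree d.+1 i).2 < dim d)%N & mulT d (tree d.+1 i).1 (tree d.+1 i).2 = [:: (1, i)]].
Proof.
move=> id; have /and5P[/allP H _ _ _ _] := chk_level (ltnW (dim_lt id)).
have /H : i \in iota 0 (dim d.+1) by rewrite mem_iota.
by case/and3P=> ? ? /eqP.
Qed.

Lemma mulTP d e i t : (e < k)%N -> (i < dim d)%N -> t \in mulT d e i ->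
  (t.2 < dim d.+1)%N /\ pos d.+1 t.2 = swap (ends e) (pos d i).
Proof.
move=> ek id ti; have /and5P[_ /allP H _ _ _] := chk_level (dim_lt id).
have /H/allP/(_ i) : e \in iota 0 k by rewrite mem_iota.
by rewrite mem_iota => /(_ id)/allP/(_ _ ti)/andP[-> /eqP].
Qed.

Lemma mulT_sub (h : nat) : (h < k.-1)%N -> mulT 0 h 0 = [::].
Proof.
move=> hk; have d0 : (0 < dim 0)%N by rewrite dim0.
have /and5P[_ _ /= /allP H _ _] := chk_level (dim_lt d0).
by apply/eqP/H; rewrite mem_iota.
Qed.

Lemma skewTP d i a t : (i < dim d.+1)%N -> (a <= k)%N -> t \in skewT d.+1 i a ->
  (t.2 < dim d)%N /\ pos d t.2 = a.
Proof.
move=> id ak ti; have /and5P[_ _ _ _ /and3P[/allP H _ _]] := chk_level (ltnW (dim_lt id)).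
have /H/allP/(_ a) : i \in iota 0 (dim d.+1) by rewrite mem_iota.
by rewrite mem_iota ltnS => /(_ ak)/allP/(_ _ ti)/andP[-> /eqP].
Qed.

Lemma leibnizP d e i a f : (e < k)%N -> (i < dim d)%N -> (a <= k)%N ->
  let c := swap (ends e) (pos d i) in a != c ->
  vlin (fun j => vlin f (skewT d.+1 j a)) (mulT d e i) =
  (sgn (c, a) (ends e))%:~R * f i +
  vlin (fun j => vlin f (mulT d.-1 e j)) (skewT d i (swap (ends e) a)).
Proof.
move=> ek id ak c ac; have /and5P[_ _ _ _ /and3P[_ /allP H _]] := chk_level (dim_lt id).
have /H/allP/(_ i) : e \in iota 0 k by rewrite mem_iota.
rewrite mem_iota => /(_ id)/allP/(_ a); rewrite mem_iota ltnS => /(_ ak).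
rewrite -/c (negPf ac) orFb => /(vlin_vzero f).
rewrite vlin_cat vlin_cons vlin_scale !vlin_app /= rmorphN /= => e0.
apply/eqP; rewrite -subr_eq0 -[X in _ == X]e0 !mulNr mul1r opprD addrA; apply/eqP.
by rewrite -addrA.
Qed.

Fixpoint bword d i : seq nat :=
  if d is d'.+1 then (tree d i).1 :: bword d' (tree d i).2 else [::].

Lemma size_bword d i : size (bword d i) = d.
Proof. by elim: d i => //= d IH i; rewrite IH. Qed.

Lemma bword_lt d i : (i < dim d)%N -> all (gtn k) (bword d i).
Proof. by elim: d i => //= d IH i /treeP[-> lt _]; apply: IH. Qed.

Lemma act_lt d w i t : all (gtn k) w -> (i < dim d)%N ->
  t \in act d w [:: (1, i)] -> (t.2 < dim (d + size w))%N.
Proof.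
elim: w t => [|e w IH] t /=; first by rewrite addn0 inE => _ id /eqP->.
case/andP=> ek wk id /flattenP[_ /mapP[s sv ->] /mapP[x xv ->]] /=.
rewrite addnS; exact: (mulTP ek (IH _ wk id sv) xv).1.
Qed.

Section Spanning.

(** Reduction in [A_k]: membership in the sum of the ideal and the span of [B], without fixing
    coefficients. *)
Definition red (B : seq nat -> Prop) (x : fa nat) : Prop :=
  span (fun y => sandwich (stage_rel k) y \/ exists2 w, B w & y = fa_word w) x.

Lemma red_word (B : seq nat -> Prop) w : B w -> red B (fa_word w).
Proof. by move=> Bw; apply: span_gen; right; exists w. Qed.

Lemma red_mul (a b : seq nat) (B B' : seq nat -> Prop) p q :
  (forall w, B w -> red B' (fa_word (a ++ w ++ b))) ->
  (forall g, lin g q = lin (fun w => g (a ++ w ++ b)) p) -> red B p -> red B' q.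
Proof.
move=> BB' e; apply: span_bind e => x y [[a' [b' [r [Sr ->]]]]|[w Bw ->]] e.
  apply: (@span_ext _ _ (fa_mul (fa_word (a ++ a')) (fa_mul r (fa_word (b' ++ b))))).
    by move=> g; rewrite e !lin_sandwich; apply: eq_lin => w; rewrite !catA.
  by apply: span_gen; left; exists (a ++ a'), (b' ++ b), r.
by apply: span_ext (BB' _ Bw) => g; rewrite e !lin_word.
Qed.

(** Filtration by the degree of the module part [u] in a product [u h]. The length of [h] is
    unrestricted, so the filtration is stable under right multiplication by stage [k.-1]. *)
Definition below d w : Prop := exists d' i h,
  [/\ (d' < d)%N, (i < dim d')%N, all (gtn k.-1) h & w = bword d' i ++ h].

Lemma below_leq d d' w : (d <= d')%N -> below d w -> below d' w.
Proof.
move=> dd [d0 [i [h [lt id hk ->]]]]; exists d0, i, h; split=> //.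
exact: leq_trans dd.
Qed.

Lemma red_below d d' p : (d <= d')%N -> red (below d) p -> red (below d') p.
Proof.
move=> dd; apply: span_sub => x [Sx|[w Bw ->]].
  by apply: span_gen; left.
by apply: red_word; apply: below_leq dd Bw.
Qed.

Lemma red_mulr d h p q : all (gtn k.-1) h ->
  (forall g, lin g q = lin (fun w => g (w ++ h)) p) ->
  red (below d) p -> red (below d) q.
Proof.
move=> hk e; apply: (@red_mul [::] h _ _ p q _ e) => w [d0 [i [h' [lt id hk' ->]]]].
by apply: red_word; exists d0, i, (h' ++ h); split=> //; rewrite /= ?all_cat ?hk' // catA.
Qed.

Definition short d := forall w, all (gtn k) w -> (size w < d)%N ->
  red (below d) (fa_word w).

(** The table holds only modulo [A_k A_(k-1)^+]; the difference from the true product has to reduce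
    to words of smaller module degree. *)
Definition excess d e i : fa nat :=
  (1, e :: bword d i) :: [seq (- t.1%:~R, bword d.+1 t.2) | t <- mulT d e i].

Lemma lin_excess g d e i : lin g (excess d e i) =
  g (e :: bword d i) - vlin (fun j => g (bword d.+1 j)) (mulT d e i).
Proof.
by rewrite lin_cons mul1r linN_vec.
Qed.

Definition closed d := forall e i, (e < k)%N -> (i < dim d)%N ->
  red (below d.+1) (excess d e i).

Lemma red_mull d e p q : (e < k)%N -> short d.+1 ->
  (forall g, lin g q = lin (fun w => g (e :: w)) p) ->
  red (below d) p -> red (below d.+1) q.
Proof.
move=> ek sh eq; apply: (@red_mul [:: e] [::]); last first.
  by move=> g; rewrite eq; apply: eq_lin => w; rewrite cats0.
move=> w [d' [i [h [lt id hk ->]]]].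
apply: (@red_mulr _ h (fa_word (e :: bword d' i))) => //.
  by move=> g; rewrite !lin_word cats0.
by apply: sh; rewrite /= ?size_bword ?ek ?bword_lt.
Qed.

(** Reduce the tail of the word first. Left multiplication by [e] then either stays shorter than
    [d], or reaches degree [d], where the table in degree [d.-1] applies. *)
Lemma short_step d : short d -> (d = 0%N \/ closed d.-1) -> short d.+1.
Proof.
move=> sh cl [|e w] /=.
  move=> _ _; apply: red_word; exists 0%N, 0%N, [::]; split=> //.
  by rewrite dim0.
case/andP=> ek wk; rewrite ltnS => lt; case: cl => [d0|cl].
  by rewrite d0 in lt.
apply: (@red_mul [:: e] [::] _ _ (fa_word w)) (sh _ wk _).
- move=> _ [d' [i [h [lt' id hk ->]]]].
  have [e'|ne] := eqVneq d'.+1 d; last first.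
    apply: (@red_below d) => //.
    apply: (@red_mulr _ h (fa_word (e :: bword d' i))) => //.
      by move=> g; rewrite !lin_word cats0.
    by apply: sh; rewrite /= ?size_bword ?ek ?bword_lt // ltn_neqAle ne.
  rewrite -e' /= in cl *.
  apply: (@red_mulr _ h (fa_word (e :: bword d' i))) => //.
    by move=> g; rewrite !lin_word cats0.
  apply: (@span_ext _ _ (fa_add (excess d' e i)
     [seq (t.1%:~R, bword d'.+1 t.2) | t <- mulT d' e i])).
    move=> g; rewrite lin_add lin_excess lin_word /vlin /lin big_map.
    by rewrite subrK.
  apply: span_add; first exact: red_below (cl _ _ ek id).
  apply: (@span_sum _ _ _ (mulT d' e i) (fun t => t.1%:~R)
    (fun t => fa_word (bword d'.+1 t.2))) => [t ti|g].
    apply: red_word; exists d'.+1, t.2, [::]; split; rewrite ?cats0 //.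
    exact: (mulTP ek id ti).1.
  by rewrite /lin big_map; apply: eq_bigr => t _; rewrite -/(lin _ _) lin_word.
- by move=> g; rewrite !lin_word cats0.
by [].
Qed.

(** The table replaces the product one letter at a time; the error made so far is multiplied by the
    next letter and stays in the filtration by [red_mull]. *)
Lemma red_act d s w j : (forall d', (d' < d)%N -> short d'.+1 /\ closed d') ->
  all (gtn k) w -> (s + size w <= d)%N -> (j < dim s)%N ->
  red (below (s + size w))
   ((1, w ++ bword s j) :: [seq (- t.1%:~R, bword (s + size w) t.2) | t <- act s w [:: (1, j)]]).
Proof.
move=> IHd; elim: w => [|e w IH] /=.
  move=> _ _ js; apply: span0 => g; rewrite !lin_cons lin_nil addn0 /=; ring.
case/andP=> ek wk; rewrite addnS => sd js.
have {}IH := IH wk (ltnW sd) js.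
have [sh cl] := IHd _ sd.
have vl t := @act_lt s w j t wk js.
set v := act s w _ in IH vl *.
set x := (X in red _ X) in IH.
apply: (@span_ext _ _ (fa_add [seq (t.1, e :: t.2) | t <- x]
   (flatten [seq fa_scale t.1%:~R (excess (s + size w) e t.2) | t <- v]))).
  move=> g; rewrite lin_add lin_flatten [lin g (map _ x)]big_map.
  rewrite -/(lin (fun w => g (e :: w)) x) /x !lin_cons !linN_vec !mul1r vlin_app big_map.
  under [X in _ + X = _]eq_bigr do rewrite lin_scale lin_excess mulrBr.
  by rewrite sumrB /vlin addrA subrK.
apply: span_add; first by apply: (red_mull ek sh _ IH) => g; rewrite [LHS]big_map.
apply: (@span_sum _ _ _ v (fun t => t.1%:~R) (fun t => excess (s + size w) e t.2)).
  by move=> t tv; apply: cl => //; apply: vl.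
by move=> g; rewrite lin_flatten big_map; apply: eq_bigr => t _; rewrite lin_scale.
Qed.

Lemma lin_row g d r j :
  \sum_(t <- row L d r j) t.1%:~R * g t.2 =
  \sum_(t <- r) t.1%:~R *
     vlin (fun i => g (head 0%N t.2, i)) (act (d - (size t.2).-1) (behead t.2) [:: (1, j)]).
Proof.
rewrite big_flatten big_map; apply: eq_bigr => t _; rewrite big_map /vlin mulr_sumr.
by apply: eq_bigr => s _; rewrite intrM mulrA.
Qed.

(** [r] times a basis word lies in the ideal. Evaluating all letters but the first of each word by
    the table turns it into the row. *)
Lemma red_row d r j : short d.+1 ->
  (forall d', (d' < d)%N -> short d'.+1 /\ closed d') ->
  r \in stage_rels k -> constant [seq size t.2 | t <- r] ->
  (forall t, t \in r -> [/\ all (gtn k) t.2, t.2 != [::], ((size t.2).-1 <= d)%N &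
     (j < dim (d - (size t.2).-1))%N]) ->
  red (below d.+1) [seq (t.1%:~R, t.2.1 :: bword d t.2.2) | t <- row L d r j].
Proof.
move=> sh IHd rk cR rP.
have [m rm] : exists m, forall t, t \in r -> size t.2 = m.
  case: r {rk rP} cR => [|t0 r]; first by exists 0%N.
  move=> /allP H; exists (size t0.2) => t; rewrite inE => /orP[/eqP-> //|tr].
  by have /H/eqP : size t.2 \in [seq size t.2 | t <- r] by apply: map_f.
(* All words of [r] have length [m], so their tails take degree [s] to degree [d]. *)
pose s := (d - m.-1)%N.
have sE t : t \in r -> (d - (size t.2).-1)%N = s.
  move=> tr; suff -> : size t.2 = m by [].
  exact: rm.
pose v (t : int * seq nat) := act s (behead t.2) [:: (1, j)].
pose x (t : int * seq nat) : fa nat := (1, t.2 ++ bword s j) ::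
  [seq (- z.1%:~R, head 0%N t.2 :: bword d z.2) | z <- v t].
have rx t : t \in r -> red (below d.+1) (x t).
  move=> tr; have [tk t0 td tj] := rP t tr; rewrite (sE t tr) in tj.
  have ds : (s + size (behead t.2) = d)%N by rewrite size_behead -(sE t tr) subnK.
  have ek : (head 0%N t.2 < k)%N by case: (t.2) tk t0 => //= ? ? /andP[].
  have bk : all (gtn k) (behead t.2) by case: (t.2) tk => //= ? ? /andP[].
  have sd : (s + size (behead t.2) <= d)%N by rewrite ds.
  have := red_act IHd bk sd tj; rewrite ds; apply: red_mull ek sh _ => g.
  rewrite /x /v !lin_cons linN_vec (linN_vec g (fun i => head 0%N t.2 :: bword d i)).
  by case: (t.2) t0.
pose y := fa_mul (fa_word [::]) (fa_mul (relfa r) (fa_word (bword s j))).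
apply: (@span_ext _ _ (fa_add y (flatten [seq fa_scale (- t.1%:~R) (x t) | t <- r]))).
  move=> g; rewrite lin_add lin_sandwich lin_flatten [RHS]big_map.
  rewrite (lin_row (fun p => g (p.1 :: bword d p.2))) [lin _ (relfa r)]big_map big_map -big_split.
  apply: eq_big_seq => t tr.
  rewrite (sE t tr) lin_scale /x lin_cons (linN_vec g (fun i => head 0%N t.2 :: bword d i)) /= mul1r /v; ring.
apply: span_add; first by apply: span_gen; left; exists [::], (bword s j), (relfa r); split=> //; exists r.
apply: (@span_sum _ _ _ r (fun t => - t.1%:~R) x) => // g.
by rewrite lin_flatten big_map; apply: eq_bigr => t _; rewrite lin_scale.
Qed.

(** Since the table satisfies the row, the row equals the same combination of excesses. The row
    reduces, and so do all its excesses except possibly that of [p]; dividing by the coefficient of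
    [p] settles that one. *)
Lemma closed_order d K os : short d.+1 ->
  (forall d', (d' < d)%N -> short d'.+1 /\ closed d') ->
  (forall p, p \in K -> red (below d.+1) (excess d p.1 p.2)) ->
  check_order L k d K os -> closed d.
Proof.
move=> sh IHd; elim: os K => [|[p [r j]] os IH] K Kr /=.
  move=> /allP H e i ek id; apply: (Kr (e, i)).
  have /H/allP/(_ i) : e \in iota 0 k by rewrite mem_iota.
  by apply; rewrite mem_iota.
set R := nth _ _ r; case/andP=> rc /and5P[/allP rP rK rp rz]; apply: IH => q.
rewrite inE => /orP[/eqP->{q}|/Kr //].
have Rk : R \in stage_rels k.
  rewrite /R; case: (ltnP r (size (stage_rels k))) => [|le]; first exact: mem_nth.
  by move: rp; rewrite /R nth_default.
have {}rP t : t \in R -> [/\ all (gtn k) t.2, t.2 != [::], ((size t.2).-1 <= d)%N &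
     (j < dim (d - (size t.2).-1))%N].
  by move=> /rP/and4P[].
have rr := red_row sh IHd Rk rc rP.
set rw := row L d R j in rr rK rp rz.
have rp0 : (vco rw p)%:~R != 0 :> rat by rewrite intr_eq0.
apply: (@span_ext _ _ (fa_scale (vco rw p)%:~R^-1 (fa_add
   [seq (t.1%:~R, t.2.1 :: bword d t.2.2) | t <- rw]
   (flatten [seq fa_scale (- t.1%:~R) (excess d t.2.1 t.2.2) | t <- rw & t.2 != p])))).
  move=> g; rewrite lin_scale; apply: (mulfI rp0); rewrite mulrA divff // mul1r.
  rewrite lin_add lin_flatten [lin g (map _ rw)]big_map big_map.
  under [X in _ + X]eq_bigr do rewrite lin_scale.
  pose E q := lin g (excess d q.1 q.2).
  have -> : \sum_(t <- rw) t.1%:~R * g (t.2.1 :: bword d t.2.2) = \sum_(t <- rw) t.1%:~R * E t.2.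
    have := vlin_vzero (fun j => g (bword d.+1 j)) rz.
    rewrite /vlin big_flatten big_map => z.
    rewrite -[LHS]subr0 -[X in _ - X = _]z -sumrB; apply: eq_bigr => t _.
    rewrite /E lin_excess mulrBr; congr (_ - _).
    by rewrite -/(vlin (fun j => g (bword d.+1 j)) _) vlin_scale.
  rewrite (bigID (fun t => t.2 == p)) /= -addrA big_filter -big_split /= [X in _ + X]big1.
    rewrite addr0 vcoE mulr_suml; apply: eq_bigr => t /eqP tp.
    by rewrite /E tp.
  by move=> t _; rewrite /E; ring.
apply: span_scale; apply: span_add => //.
apply: (@span_sum _ _ _ [seq t <- rw | t.2 != p] (fun t => - t.1%:~R) (fun t => excess d t.2.1 t.2.2)) => [t|g].
  rewrite mem_filter => /andP[tp tr]; move/allP: rK => /(_ _ tr).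
  by rewrite (negPf tp) => /Kr.
by rewrite lin_flatten big_map; apply: eq_bigr => t _; rewrite lin_scale.
Qed.

Lemma short_closed d : short d.+1 /\ closed d.
Proof.
elim/ltn_ind: d => d IHd.
have sh : short d.+1.
  case: d IHd => [|d] IHd; first by apply: short_step; [|left].
  by have [? ?] := IHd d (ltnSn d); apply: short_step; [|right].
(* Past the last level the module is zero and nothing is to be shown. *)
split=> //; have [dL|/dim_default d0] := ltnP d (size L); last by move=> e i _; rewrite d0.
have /and5P[_ _ _ co _] := chk_level dL.
apply: closed_order sh IHd _ co => p; rewrite mem_cat => /orP[].
  case/(nthP (0, 0)%N) => i id <-; have [ek pd m] := treeP id.
  by apply: span0 => g; rewrite lin_excess m vlin_cons vlin_nil /= mul1r addr0 subrr.
case: eqP => // ->; case/mapP => h; rewrite mem_iota /= => hk ->.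
(* The table value is zero and the excess is the word [[:: h]] itself: the empty basis word followed
   by the right factor [h]. *)
rewrite /excess /= mulT_sub //; apply: (@red_word (below 1) [:: h]).
by exists 0%N, 0%N, [:: h]; rewrite dim0 /= andbT.
Qed.

Lemma red_all w : all (gtn k) w ->
  red (fun w => exists d i h, [/\ (i < dim d)%N, all (gtn k.-1) h & w = bword d i ++ h]) (fa_word w).
Proof.
move=> wk; have [sh _] := short_closed (size w).
apply: span_sub (sh w wk (ltnSn _)) => x [Sx|[w' [d [i [h [_ id hk ->]]]] ->]].
  by apply: span_gen; left.
by apply: red_word; exists d, i, h.
Qed.
End Spanning.
End Stage.

(** * Independence *)

Lemma eq_lin_nz (T : eqType) (g1 g2 : T -> rat) (p : seq (rat * T)) :
  (forall t, t \in p -> t.1 != 0 -> g1 t.2 = g2 t.2) -> lin g1 p = lin g2 p.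
Proof.
move=> e; apply: eq_big_seq => t tp.
by case: (eqVneq t.1 0) => [->|/(e t tp)->//]; rewrite !mul0r.
Qed.

Fixpoint skewl (t : nat * nat) (w : seq nat) : fa nat :=
  if w is e :: w' then
    ((sgn t (ends e))%:~R, w') :: [seq (s.1, e :: s.2) | s <- skewl (conj (ends e) t) w']
  else [::].

Lemma lin_skewl_cons g t e w : lin g (skewl t (e :: w)) =
  (sgn t (ends e))%:~R * g w + lin (fun w' => g (e :: w')) (skewl (conj (ends e) t) w).
Proof. by rewrite /= lin_cons /= /lin big_map. Qed.

Lemma lin_skew_map g t w :
  lin g (skew t (map ends w)) = lin (fun w' => g (map ends w')) (skewl t w).
Proof.
elim: w t g => [|e w IH] t g; first by rewrite !lin_nil.
by rewrite lin_skewl_cons -(IH _ (fun w' => g (ends e :: w'))) lin_skew_cons.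
Qed.

Lemma lin_skewl_cat g t u v : lin g (skewl t (u ++ v)) =
  lin (fun u' => g (u' ++ v)) (skewl t u) +
  lin (fun v' => g (u ++ v')) (skewl (foldl (fun t e => conj (ends e) t) t u) v).
Proof.
elim: u t g => [|e u IH] t g; first by rewrite lin_nil add0r.
by rewrite cat_cons !lin_skewl_cons IH addrA.
Qed.

Lemma skewl_size t w s : s \in skewl t w -> (size s.2).+1 = size w.
Proof.
elim: w t s => //= e w IH t s; rewrite inE => /orP[/eqP->//|/mapP[s' /IH e' ->]] /=.
by rewrite e'.
Qed.

Lemma skewl_all (P : pred nat) t w s : s \in skewl t w -> all P w -> all P s.2.
Proof.
elim: w t s => //= e w IH t s; rewrite inE => /orP[/eqP->|/mapP[s' s'w ->]] /andP[Pe Pw] //=.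
by rewrite Pe (IH _ _ s'w).
Qed.

Lemma swap_conj e t x : swap (conj e t) x = swap e (swap t (swap e x)).
Proof.
have E y : (x == swap e y) = (swap e x == y).
  by rewrite -(inj_eq (can_inj (swapK e))) swapK.
by rewrite {1}/swap /= !E [swap t _]/swap; do !case: ifP => _; rewrite ?swapK.
Qed.

Lemma sgn_swap t e x : sgn t e != 0 -> swap t x = swap e x.
Proof.
rewrite /sgn; case: (t =P e) => [->//|_]; case: (t =P (e.2, e.1)) => [->|//] _.
rewrite /swap /=; case: (eqVneq x e.2) => [->|_] //.
by case: (eqVneq e.2 e.1) => [->|].
Qed.

(* The image of vertex [k] under the permutation of the word [w]. *)
Definition posw k (w : seq nat) := foldr (fun e x => swap (ends e) x) k w.

(** A letter deleted with nonzero coefficient is [t] conjugated by the letters before it, so the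
    permutation of the word is [t] times that of the shortened word. *)
Lemma posw_skewl k t w s : s \in skewl t w -> s.1 != 0 -> posw k w = swap t (posw k s.2).
Proof.
elim: w t s => //= e w IH t s; rewrite inE => /orP[/eqP-> /=|/mapP[s' s'w ->] /= nz].
  by rewrite intr_eq0 => /sgn_swap->.
by rewrite (IH _ _ s'w nz) swap_conj swapK.
Qed.

Lemma pairing_posw k D w : pairing D (map ends w) != 0 -> posw k w = foldr swap k D.
Proof.
elim: D w => [|t D IH] w /=; first by case: w.
rewrite lin_skew_map => nz.
have [/hasP[s sw /andP[s0 /IH <-]]|/hasPn no] :=
  boolP (has (fun s => (s.1 != 0) && (pairing D (map ends s.2) != 0)) (skewl t w)).
  exact: posw_skewl sw s0.
case/eqP: nz; rewrite -[RHS](lin0 (skewl t w)); apply: eq_lin_nz => s sw s0.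
by move: (no s sw); rewrite s0 negbK => /eqP.
Qed.

Lemma swap_le k e x : (e < k)%N -> (x <= k)%N -> (swap (ends e) x <= k)%N.
Proof.
move=> ek xk; have /andP[e1 e2] := ends_le e.
by rewrite /swap; do !case: ifP => _ //; apply: leq_trans ek.
Qed.

(** Letters below [k.-1] fix vertex [k], so the transposition keeps [k] as its first end and matches
    no letter. This is why the derivations commute with right multiplication by [A_(k-1)]. *)
Lemma skewl_fixed k x h g : all (gtn k.-1) h -> lin g (skewl (k, x) h) = 0.
Proof.
elim: h x g => [|e h IH] x g; first by rewrite lin_nil.
case/andP=> ek hk; have {}ek : (e.+1 < k)%N by case: (k) ek.
have /andP[e1 e2] := ends_le e.
have n1 : (k == (ends e).1) = false by rewrite gtn_eqF // (leq_ltn_trans e1).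
have n2 : (k == (ends e).2) = false by rewrite gtn_eqF // (leq_ltn_trans e2).
rewrite lin_skewl_cons /conj /sgn /= {1}/swap n1 n2 IH //.
by case: (ends e) n1 n2 => p q /= n1 n2; rewrite !xpair_eqE n1 n2 subrr mul0r addr0.
Qed.

(** After the derivation along [(c, a)] the surviving words move [k] to [a], so the next
    transposition starts at [a]. A complete walk ends at [k], the position of the empty word. *)
Fixpoint walk (c : nat) (p : seq nat) : seq (nat * nat) :=
  if p is a :: p' then (c, a) :: walk a p' else [::].

Fixpoint is_walk k (c : nat) (p : seq nat) : bool :=
  if p is a :: p' then [&& (a <= k)%N, a != c & is_walk k a p'] else c == k.

Lemma walk_le k c p : (c <= k)%N -> is_walk k c p ->
  all (fun t => (t.1 <= k)%N && (t.2 <= k)%N) (walk c p).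
Proof. by elim: p c => //= a p IH c ck /and3P[ak _ wp]; rewrite ck ak IH. Qed.

Lemma foldr_walk k c p D : is_walk k c p ->
  all (fun t => (t.1 < k)%N && (t.2 < k)%N) D -> foldr swap k (walk c p ++ D) = c.
Proof.
elim: p c => [|a p IH] c /=.
  move=> /eqP-> ; elim: D => //= t D IHD /andP[/andP[t1 t2] /IHD ->].
  by rewrite /swap !gtn_eqF.
case/and3P=> _ ac wp DK; rewrite IH // /swap /= eqxx.
by rewrite (negPf ac).
Qed.

Section Independence.
Variables (L : seq level) (k : nat).
Hypothesis chk : check L k.
Local Notation dim := (dim L).
Local Notation tree := (tree L).
Local Notation pos := (pos L).
Local Notation mulT := (mulT L).
Local Notation skewT := (skewT L).
Local Notation act := (act L).
Local Notation bword := (bword L).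

Definition rho (w : seq nat) : svec := act 0 w [:: (1, 0%N)].

Lemma rhoP w t : all (gtn k) w -> t \in rho w ->
  (t.2 < dim (size w))%N /\ pos (size w) t.2 = posw k w.
Proof.
rewrite /rho; elim: w t => [|e w IH] t /=.
  by rewrite inE => _ /eqP-> /=; rewrite (dim0 chk) (pos0 chk).
case/andP=> ek wk /flattenP[_ /mapP[s sv ->] /mapP[x xv ->]] /=.
have [lt <-] := IH s wk sv; rewrite add0n in xv.
exact: (mulTP chk ek lt xv).
Qed.

Lemma rho_bword d i : (i < dim d)%N -> rho (bword d i) = [:: (1, i)].
Proof.
rewrite /rho; elim: d i => [|d IH] i.
  by rewrite (dim0 chk); case: i.
move=> id; have [_ pd m] := treeP chk id.
by rewrite /= (IH _ pd) size_bword add0n /vapp /= m /vscale /= mulr1.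
Qed.

Lemma posw_bword d i : (i < dim d)%N -> posw k (bword d i) = pos d i.
Proof.
move=> id; have [|_] := @rhoP (bword d i) (1, i) (bword_lt chk id).
  by rewrite rho_bword ?mem_head.
by rewrite size_bword.
Qed.

Lemma pos_le d i : (i < dim d)%N -> (pos d i <= k)%N.
Proof.
move=> id; rewrite -posw_bword //; elim: (bword d i) (bword_lt chk id) => //= e w IH /andP[ek wk].
exact: swap_le ek (IH wk).
Qed.

(** The derivation on words induces the tabulated one on the module; the checked Leibniz rule is the
    induction step. *)
Lemma rho_skewl w a f : all (gtn k) w -> (a <= k)%N -> a != posw k w ->
  lin (fun w' => vlin f (rho w')) (skewl (posw k w, a) w) =
  vlin (fun i => vlin f (skewT (size w) i a)) (rho w).
Proof.
elim: w a f => [|e w IH] a f wk ak ac.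
  rewrite lin_nil -[LHS](vlin0 (rho [::])).
  by apply: eq_in_vlin => t _; rewrite (skewT0 chk) vlin_nil.
case/andP: wk => ek wk; rewrite lin_skewl_cons.
have pe : posw k (e :: w) = swap (ends e) (posw k w) by [].
have ce : conj (ends e) (posw k (e :: w), a) = (posw k w, swap (ends e) a).
  by rewrite pe /conj /= swapK.
rewrite ce pe; rewrite pe in ac.
have ac' : swap (ends e) a != posw k w.
  by apply: contraNneq ac => <-; rewrite swapK.
have e1 : lin (fun w' => vlin f (rho (e :: w'))) (skewl (posw k w, swap (ends e) a) w) =
  lin (fun w' => vlin (fun i => vlin f (mulT (size w).-1 e i)) (rho w'))
    (skewl (posw k w, swap (ends e) a) w).
  by apply: eq_in_lin => s /skewl_size <-; rewrite /rho /= vlin_app add0n.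
rewrite e1 IH ?swap_le // /rho /= vlin_app add0n -/(rho w).
rewrite ![vlin _ (rho w)]/vlin mulr_sumr -big_split; apply: eq_big_seq => t tw /=.
have [lt pt] := rhoP wk tw.
have := @leibnizP _ _ chk (size w) e t.2 a f ek lt ak; rewrite pt => ->; last by [].
by rewrite mulrDr; congr (_ + _); rewrite mulrCA.
Qed.

(** The value 1 at the empty list is the constant term in degree 0 only, so this is used for degrees
    at most [size p]. *)
Fixpoint eval (p : seq nat) d i : rat :=
  if p is a :: p' then vlin (eval p' d.-1) (skewT d i a) else 1.

Lemma eval_short p d i : (d < size p)%N -> eval p d i = 0.
Proof.
elim: p d i => //= a p IH [|d] i lt; first by rewrite (skewT0 chk) vlin_nil.
rewrite -[RHS](vlin0 (skewT d.+1 i a)).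
by apply: eq_in_vlin => t _; rewrite IH.
Qed.

(** Past [u] each transposition of the walk has become [(k, _)] and contributes nothing on [h]. So
    the walk acts on [u] alone and [D] on [h] alone. *)
Lemma pairing_walk p D u h : all (gtn k) u -> all (gtn k.-1) h ->
  is_walk k (posw k u) p -> (size u <= size p)%N ->
  pairing (walk (posw k u) p ++ D) (map ends (u ++ h)) =
  vlin (eval p (size u)) (rho u) * pairing D (map ends h).
Proof.
elim: p u => [|a p IH] u uk hk.
  by case: u uk => // _ _ _; rewrite [vlin _ _]big_seq1 mulr1z !mul1r.
move=> /= /and3P[ak ac wp] up.
rewrite lin_skew_map lin_skewl_cat.
have -> : foldl (fun t e => conj (ends e) t) (posw k u, a) u =
   (k, (foldl (fun t e => conj (ends e) t) (posw k u, a) u).2).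
  rewrite [LHS]surjective_pairing; congr (_, _).
  have f1 u' x : (foldl (fun t e => conj (ends e) t) (posw k u', x) u').1 = k.
    by elim: u' x => //= e u' IHu x; rewrite /conj /= swapK IHu.
  exact: f1.
rewrite (@skewl_fixed k _ h) // addr0 -rho_skewl // -linZr.
apply: eq_lin_nz => s su s0.
(* A term with nonzero coefficient moves [k] to [a], where the rest of the walk starts. *)
have pa : posw k s.2 = a.
  apply: (can_inj (swapK (posw k u, a))); rewrite -(posw_skewl k su s0) /swap /=.
  by rewrite (negPf ac) eqxx.
rewrite -{1}pa IH ?pa //; last 2 first.
- exact: skewl_all su uk.
- by rewrite -ltnS (skewl_size su).
by rewrite -(skewl_size su).
Qed.

Lemma check_peelP d Z zs (y : nat -> rat) :
  check_peel L k d Z zs ->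
  (forall i, i \in Z -> (i < dim d.+1)%N -> y i = 0) ->
  (forall c a j, (a <= k)%N -> a != c -> (j < dim d)%N -> pos d j = a ->
     \sum_(i <- iota 0 (dim d.+1) | pos d.+1 i == c) y i * (vco (skewT d.+1 i a) j)%:~R = 0) ->
  forall i, (i < dim d.+1)%N -> y i = 0.
Proof.
move=> + + H; elim: zs Z => [|[i [a j]] zs IH] Z /=.
  by move=> /allP cz Z0 i id; apply: Z0 => //; apply: cz; rewrite mem_iota.
case/and5P=> ak ac jd /eqP pj /and3P[v0 /allP u cz] Z0; apply: IH cz _ => i'.
rewrite inE => /orP[/eqP-> {i'} id|]; last exact: Z0.
have := H _ a j ak ac jd pj.
rewrite big_mkcond (bigD1_seq i) ?mem_iota ?iota_uniq //= eqxx big_seq_cond big1 ?addr0.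
  by move=> /eqP; rewrite mulf_eq0 intr_eq0 (negPf v0) orbF => /eqP.
move=> i'; rewrite mem_iota => /andP[i'd ni]; case: eqP => // pi'.
have /u : i' \in iota 0 (dim d.+1) by rewrite mem_iota.
rewrite (negPf ni) pi' eqxx /= => /orP[/Z0 ->|/eqP ->]; rewrite ?mul0r ?mulr0 //.
Qed.

(** Induction on the degree: the derivative of [y] towards [a] is killed by all walks from [a],
    hence is zero, and peeling then makes [y] vanish. *)
Lemma eval_nondegenerate d c (y : nat -> rat) :
  (forall p, is_walk k c p -> size p = d ->
     \sum_(i <- iota 0 (dim d) | pos d i == c) y i * eval p d i = 0) ->
  forall i, (i < dim d)%N -> pos d i = c -> y i = 0.
Proof.
elim: d c y => [|d IH] c y H i id.
  rewrite (dim0 chk) in id; case: i id => // _; rewrite (pos0 chk) => kc.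
  have := H [::]; rewrite /= kc eqxx => /(_ isT erefl).
  by rewrite (dim0 chk) /= big_cons big_nil (pos0 chk) kc eqxx /= mulr1 addr0.
move=> pc; have dL := ltnW (dim_lt id).
have /and5P[_ _ _ _ /and3P[_ _ cp]] := chk_level chk dL.
(* The peeling check treats all images of [k] at once, so [y] is extended by zero outside the image
   [c]. *)
pose y' i := if pos d.+1 i == c then y i else 0.
suff : y' i = 0 by rewrite /y' pc eqxx.
move: i id {pc}; apply: (check_peelP cp) => // c' a j ak ac jd pj.
have [e|ne] := eqVneq c' c; last first.
  by rewrite big1 // => i /eqP pi; rewrite /y' pi (negPf ne) mul0r.
rewrite {c'}e in ac *.
rewrite (eq_bigr (fun i => y i * (vco (skewT d.+1 i a) j)%:~R)); last first.
  by move=> i pi; rewrite /y' pi.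
apply: (IH a (fun j => \sum_(i <- iota 0 (dim d.+1) | pos d.+1 i == c)
  y i * (vco (skewT d.+1 i a) j)%:~R) _ j jd pj) => p wp sp.
rewrite -[RHS](H (a :: p)) /= ?ak ?ac ?wp ?sp //.
under eq_bigr do rewrite mulr_suml.
rewrite exchange_big /= [LHS]big_seq_cond [RHS]big_seq_cond.
apply: eq_bigr => i; rewrite mem_iota => /andP[id _].
under eq_bigr do rewrite -mulrA.
rewrite -mulr_sumr; congr (_ * _).
have sk t : t \in skewT d.+1 i a -> t.2 \in [seq j <- iota 0 (dim d) | pos d j == a].
  move=> ti; have [lt pt] := skewTP chk id ak ti.
  by rewrite mem_filter pt eqxx mem_iota.
rewrite (@vlin_support _ _ [seq j <- iota 0 (dim d) | pos d j == a]) ?big_filter //.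
  by rewrite filter_uniq ?iota_uniq.
by move=> _ /mapP[t ti ->]; apply: sk.
Qed.
End Independence.

Lemma posw_cat k u h : all (gtn k.-1) h -> posw k (u ++ h) = posw k u.
Proof.
move=> hk; rewrite /posw foldr_cat; congr (foldr _ _ _).
elim: h hk => //= e h IH /andP[ek /IH ->].
have {}ek : (e.+1 < k)%N by case: (k) ek.
have /andP[e1 e2] := ends_le e.
by rewrite /swap !gtn_eqF // ?(leq_ltn_trans e1) ?(leq_ltn_trans e2).
Qed.

(** * Unique factorisation of words and the induction step over stages *)

Section StageBasis.
Variables (L : seq level) (k : nat).
Hypothesis chk : check L k.
Local Notation dim := (dim L).
Local Notation bword := (bword L).

Definition stage_words : seq (seq nat) :=
  [seq bword d i | d <- iota 0 (size L), i <- iota 0 (dim d)].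

Lemma stage_wordsP u : reflect (exists d i, (i < dim d)%N /\ u = bword d i) (u \in stage_words).
Proof.
apply: (iffP allpairsPdep) => [[d [i [_ + ->]]]|[d [i [id ->]]]].
  by rewrite mem_iota => id; exists d, i.
by exists d, i; rewrite !mem_iota /= (dim_lt id).
Qed.

Lemma stage_words_uniq : uniq stage_words.
Proof.
apply: allpairs_uniq_dep => [|d _|]; rewrite ?iota_uniq //.
move=> _ _ /allpairsPdep[d [i [_ + ->]]] /allpairsPdep[d' [i' [_ + ->]]] /=.
rewrite !mem_iota /= !add0n => id id' e.
have dd : d = d' by rewrite -(size_bword L d i) e size_bword.
rewrite -{}dd in id' e *.
by have := rho_bword chk id; rewrite e (rho_bword chk id') => -[->].
Qed.

(** The first letter applied to the generator cannot be a smaller one, since those kill it. *)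
Lemma bword_last d i : (i < dim d.+1)%N -> last k (bword d.+1 i) = k.-1.
Proof.
elim: d i => [|d IH] i id; have [ek pd m] := treeP chk id.
  move: pd m; rewrite (dim0 chk) /=; case: (tree L 1 i) ek => e [|//] /= ek _ m.
  apply/eqP; rewrite eqn_leq -ltnS prednK ?(stage_gt0 chk) // ek /= leqNgt.
  by apply/negP => /(mulT_sub chk) e0; rewrite e0 in m.
rewrite -[in RHS](IH _ pd) /= -/(bword d.+1 _).
by case: (bword d.+1 _) (size_bword L d.+1 (tree L d.+2 i).2).
Qed.

(** If [u] were shorter than [u'], a nonempty suffix of [u'] would begin [h]; it ends in the letter
    [k.-1], which does not occur in [h]. *)
Lemma stage_words_cat_inj u u' h h' : u \in stage_words -> u' \in stage_words ->
  all (gtn k.-1) h -> all (gtn k.-1) h' -> u ++ h = u' ++ h' -> u = u' /\ h = h'.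
Proof.
wlog le : u u' h h' / (size u <= size u')%N => [H|].
  case: (leqP (size u) (size u')) => [|/ltnW] le; first exact: H.
  by move=> us us' hk hk' /esym e; have [] := H _ _ _ _ le us' us hk' hk e.
move=> us /stage_wordsP[d [i [id u'E]]] hk hk' e.
have := congr1 (take (size u)) e; rewrite take_size_cat // take_cat ltn_neqAle le andbT.
have [es|ns] /= := eqVneq (size u) (size u').
  rewrite es subnn take0 cats0 => uu; split=> //.
  by move: e; rewrite uu => /eqP; rewrite eqseq_cat // eqxx => /eqP.
move=> uE; exfalso.
have lt : (size u < size u')%N by rewrite ltn_neqAle ns.
have := congr1 (drop (size u)) e.
rewrite drop_size_cat // drop_cat lt => hE.
have d0 : d = d.-1.+1 by case: d u'E id => // u'E _; rewrite u'E in lt.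
rewrite d0 in u'E id.
have := bword_last id; rewrite -u'E -(cat_take_drop (size u) u') last_cat.
have : size (drop (size u) u') != 0%N by rewrite size_drop subn_eq0 -ltnNge.
move: hk; rewrite hE; case: (drop _ _) => //= x s hk _ lx.
have : last x s \in x :: s ++ h' by rewrite -cat_cons mem_cat mem_last.
by move=> /(allP (hk : all _ (x :: s ++ h'))); rewrite /= lx ltnn.
Qed.

Definition ideal_or_word j (B : seq (seq nat)) (y : fa nat) : Prop :=
  sandwich (stage_rel j) y \/ exists2 w, w \in B & y = fa_word w.

Lemma stage_rels_succ r : r \in stage_rels k.-1 -> r \in stage_rels k.
Proof.
have sub : {subset iota 0 k.-1 <= iota 0 k}.
  by move=> x; rewrite !mem_iota /= !add0n => lt; apply: leq_trans lt (leq_pred _).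
rewrite !mem_cat => /or3P[/mapP[e /sub ek ->]|/allpairsPdep[e [f [/sub ek fk ->]]]|].
- by rewrite map_f.
- by apply/orP; right; apply/orP; left; apply/allpairsPdep; exists e, f.
case: ifP => // k3 H; apply/orP; right; apply/orP; right.
by rewrite (leq_trans k3 (leq_pred _)).
Qed.

Lemma stage_spanning (B : seq (seq nat)) w :
  (forall h, all (gtn k.-1) h -> span (ideal_or_word k.-1 B) (fa_word h)) ->
  all (gtn k) w ->
  span (ideal_or_word k [seq u ++ h | u <- stage_words, h <- B]) (fa_word w).
Proof.
move=> HB /(red_all chk); apply: span_sub => x [Sx|[_ [d [i [h [id hk ->]]]] ->]].
  by apply: span_gen; left.
apply: (@span_bind _ (ideal_or_word k.-1 B) _ (cat (bword d i)) (fa_word h)) (HB h hk).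
  move=> y z [[a [b [_ [[r rk ->] ->]]]]|[v vB ->]] e.
    apply: (@span_ext _ _ (fa_mul (fa_word (bword d i ++ a)) (fa_mul (relfa r) (fa_word b)))).
      by move=> g; rewrite e !lin_sandwich; apply: eq_lin => v; rewrite -catA.
    apply: span_gen; left; exists (bword d i ++ a), b, (relfa r); split=> //.
    by exists r => //; apply: stage_rels_succ.
  apply: (@span_ext _ _ (fa_word (bword d i ++ v))).
    by move=> g; rewrite e !lin_word.
  apply: span_gen; right; exists (bword d i ++ v) => //.
  by apply/allpairsPdep; exists (bword d i), v; split=> //; apply/stage_wordsP; exists d, i.
by move=> g; rewrite !lin_word.
Qed.

(** Independence in dual form: pairings on the vertices up to [j] detect all coefficients. This form
    passes to the next stage because [D] can be prefixed by a walk. *)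
Definition separated j (B : seq (seq nat)) : Prop := forall c : seq nat -> rat,
  (forall D, all (fun t => (t.1 <= j)%N && (t.2 <= j)%N) D ->
     \sum_(w <- B) c w * pairing D (map ends w) = 0) ->
  forall w, w \in B -> c w = 0.

(** Downward induction on the module degree [d]. Pairing with a walk of length [d] followed by [D]
    kills the products [u h] where [u] is shorter or moves [k] elsewhere; those with longer [u]
    already have coefficient zero. What remains factors, and nondegeneracy of walks and stage [k.-1]
    finish. *)
Lemma stage_separated (B : seq (seq nat)) :
  (forall h, h \in B -> all (gtn k.-1) h) -> separated k.-1 B ->
  separated k [seq u ++ h | u <- stage_words, h <- B].
Proof.
move=> Bk sB c H.
(* [m] bounds the number of levels from [d] upwards; for [m = 0] there are none. *)
suff top m d i h : (size L <= d + m)%N -> (i < dim d)%N -> h \in B -> c (bword d i ++ h) = 0.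
  move=> _ /allpairsPdep[u [h [/stage_wordsP[d [i [id ->]]] hB ->]]].
  by apply: (top (size L)) => //; rewrite leq_addl.
elim: m d i h => [|m IH] d i h Ld id hB.
  by rewrite addn0 in Ld; rewrite dim_default in id.
have {}IH d' i' h' : (d < d')%N -> (i' < dim d')%N -> h' \in B -> c (bword d' i' ++ h') = 0.
  by move=> dd; apply: IH; apply: leq_trans Ld _; rewrite addnS -addSn leq_add2r.
apply: (sB (fun h => c (bword d i ++ h))) hB => D DK.
have {}DK : all (fun t => (t.1 < k)%N && (t.2 < k)%N) D.
  by apply: sub_all DK => t; rewrite -(ltnS t.1) -(ltnS t.2) prednK // (stage_gt0 chk).
(* For fixed [D] the sums over [h] are the coordinates of a vector of the module. *)
apply: (@eval_nondegenerate _ _ chk d (pos L d i)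
  (fun i => \sum_(h <- B) c (bword d i ++ h) * pairing D (map ends h)) _ i id erefl).
move=> p wp sp; set c0 := pos L d i in wp *.
have ck : (c0 <= k)%N := pos_le chk id.
have term d' i' h' : (i' < dim d')%N -> h' \in B ->
  c (bword d' i' ++ h') * pairing (walk c0 p ++ D) (map ends (bword d' i' ++ h')) =
  if (d' == d) && (pos L d' i' == c0)
  then c (bword d' i' ++ h') * pairing D (map ends h') * eval L p d' i' else 0.
  move=> id' hB'; have uk := bword_lt chk id'; have hk' := Bk _ hB'.
  have pu := posw_bword chk id'.
  have nul : pos L d' i' != c0 ->
    c (bword d' i' ++ h') * pairing (walk c0 p ++ D) (map ends (bword d' i' ++ h')) = 0.
    move=> ne; apply/eqP; rewrite mulf_eq0; apply/orP; right.
    apply: contraNT ne => /(@pairing_posw k).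
    by rewrite (foldr_walk wp DK) posw_cat // pu => ->.
  case: (ltngtP d d') => [dd|lt|e].
  - by rewrite IH // mul0r.
  - have [e|/nul //] := eqVneq (pos L d' i') c0.
    rewrite -e -pu (pairing_walk chk) ?pu ?e ?size_bword ?sp //; last exact: ltnW.
    by rewrite (rho_bword chk id') vlin_cons vlin_nil (eval_short chk) ?sp // mulr0 addr0 mul0r mulr0.
  have [e'|/nul //] := eqVneq (pos L d' i') c0.
  rewrite /= -e' -pu (pairing_walk chk) ?pu ?e' ?size_bword ?sp ?e //.
  by rewrite (rho_bword chk id') vlin_cons vlin_nil mulr1z mul1r addr0 mulrA mulrAC.
have DD : all (fun t => (t.1 <= k)%N && (t.2 <= k)%N) (walk c0 p ++ D).
  rewrite all_cat walk_le //=; apply: sub_all DK => t /andP[t1 t2].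
  by rewrite (ltnW t1) (ltnW t2).
have dL := dim_lt id.
rewrite -[RHS](H _ DD) big_allpairs_dep big_allpairs_dep /=.
rewrite [RHS](bigD1_seq d) ?mem_iota ?iota_uniq //= [X in _ = _ + X]big1_seq ?addr0.
  rewrite big_mkcond [LHS]big_seq [RHS]big_seq; apply: eq_bigr => i'.
  rewrite mem_iota => /= id'; rewrite [RHS](eq_big_seq _ (fun h' => term d i' h' id')).
  rewrite eqxx /=; case: eqP => _; last by rewrite big1.
  by rewrite mulr_suml.
move=> d' /andP[dd _]; apply: big1_seq => i' /andP[_]; rewrite mem_iota => /= id'.
apply: big1_seq => h' /andP[_ hB']; rewrite term //.
by rewrite (negPf dd).
Qed.
End StageBasis.

(** * Transfer to the trees [E_m] *)

Definition stage (k : nat) : seq level :=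
  nth [::] [:: [::]; stage1; stage2; stage3; stage4; stage5; stage6; stage7] k.

(** The tables are verified here, by evaluation; the preceding results on a stage all assume
    [check]. *)
Lemma check_stage k : (0 < k <= 7)%N -> check (stage k) k.
Proof. by case: k => [|[|[|[|[|[|[|[|k]]]]]]]] // _; vm_compute. Qed.

Fixpoint basis (k : nat) : seq (seq nat) :=
  if k is k'.+1 then [seq u ++ h | u <- stage_words (stage k), h <- basis k'] else [:: [::]].

Lemma basis_letters k w : (k <= 7)%N -> w \in basis k -> all (gtn k) w.
Proof.
elim: k w => [|k IH] w k7; first by rewrite inE => /eqP->.
have chk := @check_stage k.+1 k7.
case/allpairsPdep=> u [h [/stage_wordsP[d [i [id ->]]] hB ->]].
rewrite all_cat (bword_lt chk id); apply: sub_all (IH h (ltnW k7) hB) => x.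
exact: ltnW.
Qed.

Lemma basis_uniq k : (k <= 7)%N -> uniq (basis k).
Proof.
elim: k => [//|k IH] k7; have chk := @check_stage k.+1 k7.
apply: allpairs_uniq; [exact: stage_words_uniq chk | exact: IH (ltnW k7)|].
move=> _ _ /allpairsPdep[u [h [us hB ->]]] /allpairsPdep[u' [h' [us' hB' ->]]] /=.
have lt v : v \in basis k -> all (gtn k.+1.-1) v by apply: basis_letters; apply: ltnW.
by case/(stage_words_cat_inj chk us us' (lt _ hB) (lt _ hB')) => -> ->.
Qed.

Lemma basis_spanning k w : (k <= 7)%N -> all (gtn k) w ->
  span (ideal_or_word k (basis k)) (fa_word w).
Proof.
elim: k w => [|k IH] w k7 wk.
  by case: w wk => // _; apply: span_gen; right; exists [::]; rewrite ?mem_head.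
by apply: (stage_spanning (@check_stage k.+1 k7)) wk => h; apply: IH; apply: ltnW.
Qed.

Lemma basis_separated k : (k <= 7)%N -> separated k (basis k).
Proof.
elim: k => [|k IH] k7.
  move=> c /(_ [::] isT); rewrite big_seq1 /= mulr1 => c0 w.
  by rewrite inE => /eqP->.
apply: (stage_separated (@check_stage k.+1 k7)) (IH (ltnW k7)) => h.
by apply: basis_letters; apply: ltnW.
Qed.

Lemma ideal_or_word_coef j (B : seq (seq nat)) x : uniq B ->
  span (ideal_or_word j B) x ->
  exists c : seq nat -> rat, in_ideal (stage_rel j) (x ++ [seq (- c b, b) | b <- B]).
Proof.
move=> uB [T GT eT]; elim: T x GT eT => [|t T IH] x GT eT.
  exists (fun _ => 0); apply/in_idealE/span0 => g.
  rewrite lin_cat eT big_nil add0r /lin big_map big1 // => b _.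
  by rewrite oppr0 mul0r.
have [u uT|g|c Hc] := IH (flatten [seq fa_scale u.1 u.2 | u <- T]).
- by apply: GT; rewrite inE uT orbT.
- by rewrite lin_flatten big_map; apply: eq_bigr => u _; rewrite lin_scale.
have linT g : lin g x = t.1 * lin g t.2 + lin g (flatten [seq fa_scale u.1 u.2 | u <- T]).
  by rewrite eT big_cons lin_flatten big_map; congr (_ + _); apply: eq_bigr => u _; rewrite lin_scale.
case: (GT t (mem_head _ _)) => [st|[w wB tw]].
  exists c; apply/in_idealE.
  apply: (@span_ext _ _ (fa_add (fa_scale t.1 t.2)
     (flatten [seq fa_scale u.1 u.2 | u <- T] ++ [seq (- c b, b) | b <- B]))).
    by move=> g; rewrite lin_add lin_scale !lin_cat linT addrA.
  by apply: span_add; [apply/span_scale/span_gen | apply/in_idealE].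
exists (fun b => c b + t.1 * (b == w)%:R).
apply: in_ideal_ext Hc => g; rewrite !lin_cat linT tw lin_word.
have -> : lin g [seq (- (c b + t.1 * (b == w)%:R), b) | b <- B] =
   lin g [seq (- c b, b) | b <- B] - t.1 * g w.
  rewrite /lin !big_map (bigD1_seq w) //= [in RHS](bigD1_seq w) //= eqxx mulr1.
  rewrite mulNr mulrDl opprD -mulNr addrAC; congr (_ + _ - _).
  by apply: eq_bigr => b /negPf->; rewrite mulr0 addr0.
by ring.
Qed.

Section TreeE.
Variable k : nat.
Hypothesis k57 : (4 < k < 8)%N.
Local Notation G := (Egraph k.+1).

Lemma Egraph_sym : symmetric G.
Proof. by move=> i j; rewrite /Egraph orbC. Qed.

Lemma Egraph_irr : irreflexive G.
Proof.
move=> i; rewrite /Egraph orbb /Eadj /=; apply/negbTE/negP.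
by case/orP=> /andP[/eqP ? /eqP ?]; lia.
Qed.

(** Passes from the labelling of [Egraph] to that of [ends], in which every initial segment spans a
    subtree. *)
Definition vertex (i : 'I_k.+1) : nat :=
  if (i == k :> nat) then 0 else if (i < 3)%N then (3 - i)%N else i.+1.

Lemma vertex_inj : injective vertex.
Proof.
move=> i j; rewrite /vertex => e; apply: val_inj => /=.
have := ltn_ord i; have := ltn_ord j; move: e.
by do !case: ifP => /eqP; lia.
Qed.

Definition letter (e : Edge G) : nat :=
  let p := val e in
  if (p.2 == k :> nat) then 0 else if (p.1 < 2)%N then (2 - p.1)%N else p.1.+1.

Lemma edgeP (e : Edge G) : let p := val e in
  ((p.2 : nat) = p.1.+1 /\ (p.2 < k)%N) \/ ((p.1 : nat) = 2%N /\ (p.2 : nat) = k).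
Proof.
case: e => -[i j] /= /andP[ij]; rewrite /Egraph /Eadj /=.
case/orP=> /orP[] /andP[/eqP ? H]; move: H; rewrite ?[_ == _]eqE /=; lia.
Qed.

Lemma letter_lt e : (letter e < k)%N.
Proof. have := edgeP e; rewrite /letter /=; do !case: ifP; lia. Qed.

(** The orientations agree too, so the transfer introduces no signs. The proof runs through the
    finitely many values of [k], [i] and [j]. *)
Lemma ends_letter e : ends (letter e) = (vertex (val e).1, vertex (val e).2).
Proof.
have := edgeP e; rewrite /letter /vertex /=.
case: (val e) => -[i ilt] [j jlt] /= H; move: k57 H => {ilt jlt} /andP[k4 k8].
have : k \in iota 5 3 by rewrite mem_iota; lia.
rewrite !inE => /or3P[] /eqP->; do 7 (case: i => [|i] /=; first by do 9 (case: j => [|j] //=; try lia)); lia.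
Qed.

Definition ends_of (l : nat) : nat * nat :=
  if l == 0%N then (2, k)%N else if (l < 3)%N then (2 - l, 3 - l)%N else (l.-1, l).

Lemma ends_of_edge l : (l < k)%N -> exists e : Edge G, letter e = l /\ (nat_of_ord (val e).1, nat_of_ord (val e).2) = ends_of l.
Proof.
move=> lk; have lt : ((ends_of l).1 < (ends_of l).2 < k.+1)%N.
  by move: k57; rewrite /ends_of; do !case: ifP => /=; lia.
have lt1 : ((ends_of l).1 < k.+1)%N by lia.
have lt2 : ((ends_of l).2 < k.+1)%N by lia.
pose p : 'I_k.+1 * 'I_k.+1 := (Ordinal lt1, Ordinal lt2).
have Pp : (p.1 < p.2)%N && G p.1 p.2.
  rewrite /p /= /Egraph /Eadj /= {lt1 lt2 p}; move: lt; rewrite /ends_of.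
  by move: k57; do !case: ifP => /=; lia.
exists (exist _ p Pp); split; last by rewrite /= -surjective_pairing.
rewrite /letter /= {Pp p lt1 lt2 lt} /ends_of; move: k57.
by do !case: ifP => /=; lia.
Qed.

Lemma edge0 : Edge G.
Proof.
have lt1 : (0 < k.+1)%N by []. have lt2 : (1 < k.+1)%N by lia.
exists (Ordinal lt1, Ordinal lt2); rewrite /= /Egraph /Eadj /=; lia.
Qed.

Definition edge (l : nat) : Edge G :=
  odflt edge0 (insub (inord (ends_of l).1, inord (ends_of l).2)).

Lemma edge_val l : (l < k)%N ->
  (nat_of_ord (val (edge l)).1, nat_of_ord (val (edge l)).2) = ends_of l.
Proof.
move=> /ends_of_edge[e [_ eE]].
have e1 : inord (ends_of l).1 = (val e).1 by rewrite -eE inord_val.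
have e2 : inord (ends_of l).2 = (val e).2 by rewrite -eE inord_val.
by rewrite /edge e1 e2 -surjective_pairing valK /= -eE.
Qed.

Lemma letter_edge l : (l < k)%N -> letter (edge l) = l.
Proof.
move=> lk; have [e [le eE]] := ends_of_edge lk.
rewrite /edge -eE /= !inord_val -surjective_pairing valK; exact: le.
Qed.

Lemma letter_inj : injective letter.
Proof.
move=> e f ef; apply: val_inj.
have := ends_letter e; rewrite ef ends_letter => -[/vertex_inj e1 /vertex_inj e2].
by rewrite [LHS]surjective_pairing [RHS]surjective_pairing e1 e2.
Qed.

Lemma letterK e : edge (letter e) = e.
Proof. by apply: letter_inj; rewrite letter_edge // letter_lt. Qed.
End TreeE.

Lemma pairing_size D w : size D != size w -> pairing D w = 0.
Proof.
have skew_size t v s : s \in skew t v -> (size s.2).+1 = size v.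
  elim: v t s => //= e v IH t s; rewrite inE => /orP[/eqP->//|/mapP[s' /IH e' ->]] /=.
  by rewrite e'.
elim: D w => [|t D IH] w /=; first by case: w.
move=> ne; rewrite -[RHS](lin0 (skew t w)); apply: eq_in_lin => s /skew_size sw.
by apply: IH; rewrite -sw eqSS in ne.
Qed.

Lemma sum_zip_map (T : eqType) (U : Type) (cs : seq rat) (s : seq T) (f : T -> U) (g : U -> rat) :
  uniq s -> size cs = size s ->
  \sum_(t <- zip cs [seq f b | b <- s]) t.1 * g t.2 =
  \sum_(b <- s) nth 0 cs (index b s) * g (f b).
Proof.
case: s => [|x s'] us css; first by case: cs css => //; rewrite !big_nil.
move: (x :: s') us css => {s'} s us css.
rewrite (big_nth (0, f x)) [RHS](big_nth x) size_zip size_map css minnn.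
apply: eq_big_nat => i /andP[_ lt]; rewrite nth_zip ?size_map //=.
by rewrite (nth_map x) // index_uniq.
Qed.

(** * Presentation and graded dimensions for the trees *)

Section TreeE.
Variable k : nat.
Hypothesis k57 : (4 < k < 8)%N.
Local Notation G := (Egraph k.+1).
Local Notation edge := (edge k57).

Let k7 : (k <= 7)%N.
Proof. by case/andP: k57. Qed.

Lemma stage_rel_listed r : stage_rel k r -> in_ideal (@listed_rel _ G) (fa_map edge r).
Proof.
have [k5 _] := andP k57.
have endsE e : (e < k)%N -> ends e = (vertex (val (edge e)).1, vertex (val (edge e)).2).
  by move=> ek; rewrite -ends_letter // letter_edge.
case=> s + ->; rewrite !mem_cat => /or3P[/mapP[e _ ->]|/allpairsPdep[e [f []]]|].
- apply: (@in_ideal_ext _ _ (fa_word [:: edge e; edge e])) => [g|].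
    by rewrite lin_map !lin_cons !lin_nil.
  by apply: in_ideal_gen; left; exists (edge e).
- rewrite !mem_iota /= !add0n => ek fe ->; have fk := ltn_trans fe ek.
  have ef : edge e != edge f.
    by apply: contraTneq fe => E; rewrite -(letter_edge k57 ek) -(letter_edge k57 fk) E ltnn.
  have ud : uniq [:: (ends e).1; (ends e).2; (ends f).1; (ends f).2] =
     edges_disjoint (edge e) (edge f).
    by rewrite !endsE // /edges_disjoint -(map_inj_uniq (vertex_inj k57)).
  rewrite /pair_rel ud; case: ifP => [dj|/negbT dj].
    have := listed_commute dj; apply: in_ideal_ext => g.
    by rewrite lin_map !lin_cons !lin_nil.
  have := listed_braid (@Egraph_sym k) ef dj; apply: in_ideal_ext => g.
  rewrite lin_map !lin_cons !lin_nil !endsE //= !(inj_eq (vertex_inj k57)).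
  by case: ifP.
have [k3 k1 k0] : [/\ (3 < k)%N, (1 < k)%N & (0 < k)%N] by split; lia.
rewrite k3 => H.
have [a1 a2] : nat_of_ord (val (edge 1)).1 = 1%N /\ nat_of_ord (val (edge 1)).2 = 2%N.
  by case: (edge_val k57 k1).
have [b1 b2] : nat_of_ord (val (edge 0)).1 = 2%N /\ nat_of_ord (val (edge 0)).2 = k.
  by case: (edge_val k57 k0).
have [c1 c2] : nat_of_ord (val (edge 3)).1 = 2%N /\ nat_of_ord (val (edge 3)).2 = 3%N.
  by case: (edge_val k57 k3).
have [||| cl1 cl2] := @listed_claw _ G (@Egraph_sym k) (edge 1) (edge 0) (edge 3).
- by rewrite /= !inE -!(inj_eq val_inj) /= a1 b2 c2; lia.
- by apply: val_inj; rewrite /= a2 b1.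
- by apply: val_inj; rewrite /= b1 c1.
move: H; rewrite !inE => /orP[] /eqP->; [move: cl1 | move: cl2];
  by apply: in_ideal_ext => g; rewrite lin_map !lin_cons !lin_nil.
Qed.

Lemma lin_letterK g (p : fa (Edge G)) :
  lin (fun w => g (map edge w)) (fa_map (@letter k) p) = lin g p.
Proof.
rewrite lin_map; apply: eq_lin => w.
by rewrite mapK //; apply: letterK.
Qed.

Lemma reduce (p : fa (Edge G)) : exists c : seq nat -> rat,
  in_ideal (@listed_rel _ G) (p ++ [seq (- c b, map edge b) | b <- basis k]).
Proof.
have : span (ideal_or_word k (basis k)) (fa_map (@letter k) p).
  apply: (@span_sum _ _ _ p fst (fun t => fa_word (map (@letter k) t.2))) => [t _|g].
    apply: basis_spanning => //; apply/allP => _ /mapP[e _ ->]; exact: letter_lt.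
  by rewrite lin_map; apply: eq_bigr => t _; rewrite lin_word.
case/(ideal_or_word_coef (basis_uniq k7)) => c Hc.
exists c; move: (in_ideal_map stage_rel_listed Hc); apply: in_ideal_ext => g.
by rewrite lin_map !lin_cat lin_letterK; congr (_ + _); rewrite /lin !big_map.
Qed.

Lemma kerG_pairing (p : fa (Edge G)) D : kerG p ->
  lin (fun w => pairing D (map ends (map (@letter k) w))) p = 0.
Proof.
move=> /(in_ideal_FK_pairing D (vertex_inj k57)) <-; rewrite lin_map.
apply: eq_lin => w; rewrite -!map_comp; congr pairing; apply: eq_map => e /=.
exact: ends_letter.
Qed.

Lemma kerG_ext (p q : fa (Edge G)) :
  (forall g, lin g p = lin g q) -> kerG p -> kerG q.
Proof. by move=> e; apply: in_ideal_ext => g; rewrite !lin_map e. Qed.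

Lemma letters_basis b : b \in basis k -> map (@letter k) (map edge b) = b.
Proof.
move=> /(basis_letters k7)/allP bk; rewrite -map_comp -[RHS]map_id.
by apply/eq_in_map => l /bk lk; apply: letter_edge.
Qed.

(** The listed relations hold in the Fomin-Kirillov algebra, so pairings do not distinguish [p] from
    its reduced form. *)
Lemma kerG_coef (p : fa (Edge G)) c D :
  in_ideal (@listed_rel _ G) (p ++ [seq (- c b, map edge b) | b <- basis k]) ->
  \sum_(b <- basis k) c b * pairing D (map ends b) =
  lin (fun w => pairing D (map ends (map (@letter k) w))) p.
Proof.
move=> /(kerG_listed (@Egraph_sym k) (Egraph_irr k57))/(kerG_pairing D)/eqP.
rewrite lin_cat addr_eq0 => /eqP ->; rewrite /lin big_map -sumrN.
by apply: eq_big_seq => b bB; rewrite mulNr opprK letters_basis.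
Qed.

(** A kernel element reduces to a combination of basis words with vanishing pairings; separation
    makes its coefficients zero. *)
Lemma tree_relations : relations_generated G.
Proof.
move=> p; split; last exact: kerG_listed (@Egraph_sym k) (Egraph_irr k57) _.
move=> kp; have [c Hc] := reduce p.
have c0 : forall b, b \in basis k -> c b = 0.
  apply: (basis_separated k7) => D _.
  by rewrite (kerG_coef _ Hc) kerG_pairing.
apply: in_ideal_ext Hc => g; rewrite lin_cat -[RHS]addr0; congr (_ + _).
rewrite /lin big_map big_seq big1 // => b bB.
by rewrite c0 // oppr0 mul0r.
Qed.

(** The basis words of degree [d] are independent by separation. Conversely, one element more than
    there are such words admits a nontrivial combination whose coordinates on them vanish. *)
Lemma tree_dim d : dimEG G d (count (fun b => size b == d) (basis k)).
Proof.
set Bd := [seq b <- basis k | size b == d].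
have uBd : uniq Bd by rewrite filter_uniq // basis_uniq.
rewrite -size_filter -/Bd; split.
  exists [seq fa_word (map edge b) | b <- Bd]; split; first by rewrite size_map.
  split.
    apply/allP => _ /mapP[b + ->]; rewrite mem_filter => /andP[/eqP sb _].
    by rewrite /fa_homog /= size_map sb eqxx.
  move=> cs; rewrite size_map => scs ker.
  pose c b := if size b == d then nth 0 cs (index b Bd) else 0.
  have c0 : forall b, b \in basis k -> c b = 0.
    apply: (basis_separated k7) => D _.
    rewrite -[RHS](kerG_pairing D ker) lin_lincomb sum_zip_map // big_filter [RHS]big_mkcond.
    apply: eq_big_seq => b bB; rewrite /c; case: ifP => _; last by rewrite mul0r.
    by rewrite lin_word letters_basis.
  apply/(all_nthP 0) => i; rewrite scs => iB.
  have bB : nth [::] Bd i \in Bd by apply: mem_nth.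
  move: (bB); rewrite mem_filter => /andP[/eqP sb /c0].
  by rewrite /c sb eqxx index_uniq // => ->.
move=> ps sps hom ind.
set n := size Bd in sps.
have [C HC] : exists C : 'I_n.+1 -> seq nat -> rat, forall i : 'I_n.+1, in_ideal (@listed_rel _ G)
    (nth [::] ps i ++ [seq (- C i b, map edge b) | b <- basis k]).
  by apply: (fin_all_exists (fun i : 'I_n.+1 => reduce (nth [::] ps i))).
(* More rows than columns, so the left kernel contains a nonzero vector [l]. *)
pose M : 'M[rat]_(n.+1, n) := \matrix_(i, j) C i (nth [::] Bd j).
pose l := nz_row (kermx M).
have l0 : l != 0.
  rewrite nz_row_eq0 kermx_eq0 /row_free neq_ltn.
  by rewrite (leq_ltn_trans (rank_leq_col M)).
have lM : l *m M = 0 by apply/sub_kermxP; apply: nz_row_sub.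
pose cs := [seq l 0 i | i <- enum 'I_n.+1].
have scs : size cs = size ps by rewrite size_map size_enum_ord.
have linF g : lin g (fa_lincomb cs ps) = \sum_i l 0 i * lin g (nth [::] ps i).
  rewrite lin_lincomb (big_nth (0, [::])) size_zip scs minnn sps big_mkord.
  apply: eq_bigr => i _; rewrite nth_zip //= (nth_map ord0) ?size_enum_ord //.
  by rewrite nth_ord_enum.
pose e b := \sum_i l 0 i * C i b.
have He : in_ideal (@listed_rel _ G)
    (fa_lincomb cs ps ++ [seq (- e b, map edge b) | b <- basis k]).
  apply/in_idealE; apply: (@span_sum _ _ _ (index_enum 'I_n.+1) (fun i => l 0 i)
     (fun i => nth [::] ps i ++ [seq (- C i b, map edge b) | b <- basis k])) => [i _|g].
    by apply/in_idealE.
  under [RHS]eq_bigr do rewrite lin_cat mulrDr.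
  rewrite lin_cat linF big_split; congr (_ + _); rewrite /lin big_map.
  under [RHS]eq_bigr do rewrite big_map mulr_sumr.
  rewrite exchange_big; apply: eq_bigr => b _.
  by rewrite /e -sumrN mulr_suml; apply: eq_bigr => i _ /=; ring.
have eBd b : b \in Bd -> e b = 0.
  move=> bB; have jn : (index b Bd < n)%N by rewrite index_mem.
  have := congr1 (fun A : 'rV_n => A 0 (Ordinal jn)) lM; rewrite !mxE => <-.
  by apply: eq_bigr => i _; rewrite mxE /= nth_index.
(* [reduce] does not promise to respect degrees; pairing with lists [D] of other lengths shows that
   the coefficients in other degrees vanish. *)
have homF D : size D != d ->
    lin (fun w => pairing D (map ends (map (@letter k) w))) (fa_lincomb cs ps) = 0.
  move=> Dd; rewrite linF big1 // => i _; rewrite -[RHS](mulr0 (l 0 i)); congr (_ * _).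
  rewrite -[RHS](lin0 (nth [::] ps i)); apply: eq_in_lin => t ti.
  have /allP/(_ _ ti)/eqP st : fa_homog d (nth [::] ps i).
    by move/allP: hom; apply; rewrite mem_nth // sps.
  by apply: pairing_size; rewrite !size_map st.
have e0 : forall b, b \in basis k -> e b = 0.
  apply: (basis_separated k7) => D _.
  have [Dd|nD] := eqVneq (size D) d; last by rewrite (kerG_coef _ He) homF.
  rewrite big_seq big1 // => b bB; have [sb|ns] := eqVneq (size b) d.
    by rewrite eBd ?mul0r // mem_filter sb eqxx.
  by rewrite pairing_size ?mulr0 // size_map Dd eq_sym.
have : kerG (fa_lincomb cs ps).
  apply: kerG_ext (kerG_listed (@Egraph_sym k) (Egraph_irr k57) He) => g.
  rewrite lin_cat -[RHS]addr0; congr (_ + _).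
  rewrite /lin big_map big_seq big1 // => b bB.
  by rewrite e0 // oppr0 mul0r.
move=> /(ind cs scs)/allP z; case/eqP: l0; apply/rowP => i; rewrite mxE.
by apply/eqP/z/map_f; rewrite mem_enum.
Qed.
End TreeE.

(** * Hilbert series *)

Section BinaryPoly.

(** Binary coefficients allow polynomial products to be evaluated by [vm_compute]. *)
Definition npoly (s : seq N) : {poly int} := Poly [seq (N.to_nat x)%:Z | x <- s].

Fixpoint nadd (s t : seq N) : seq N :=
  match s, t with
  | [::], _ => t
  | _, [::] => s
  | a :: s', b :: t' => N.add a b :: nadd s' t'
  end.

Fixpoint nmul (s t : seq N) : seq N :=
  if s is a :: s' then nadd [seq N.mul a b | b <- t] (N0 :: nmul s' t) else [::].

Lemma npoly_cons a s : npoly (a :: s) = npoly s * 'X + (N.to_nat a)%:Z%:P.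
Proof. exact: cons_poly_def. Qed.

Lemma npolyD s t : npoly (nadd s t) = npoly s + npoly t.
Proof.
elim: s t => [|a s IH] [|b t] /=; rewrite ?add0r ?addr0 //.
by rewrite !npoly_cons IH N2Nat.inj_add plusE PoszD polyCD mulrDl addrACA.
Qed.

Lemma npolyZ a s : npoly [seq N.mul a b | b <- s] = (N.to_nat a)%:Z%:P * npoly s.
Proof.
elim: s => [|b s IH]; first by rewrite mulr0.
by rewrite map_cons !npoly_cons IH N2Nat.inj_mul multE PoszM polyCM mulrDr mulrA.
Qed.

Lemma npolyM s t : npoly (nmul s t) = npoly s * npoly t.
Proof.
elim: s => [|a s IH]; first by rewrite mul0r.
by rewrite [nmul _ _]/= npolyD npolyZ !npoly_cons IH polyC0 addr0 mulrDl addrC mulrAC.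
Qed.

Lemma npoly_iota (f : nat -> nat) n :
  npoly [seq N.of_nat (f d) | d <- iota 0 n] = \sum_(d <- iota 0 n) (f d)%:R *: 'X^d.
Proof.
transitivity (\poly_(d < n) (f d)%:Z).
  apply/polyP => i; rewrite coef_poly coef_Poly -map_comp.
  case: ltnP => lt; last by rewrite nth_default // size_map size_iota.
  by rewrite -/(mkseq _ n) nth_mkseq //= Nat2N.id.
rewrite poly_def -[in RHS](subn0 n) -/(index_iota 0 n) big_mkord.
by apply: eq_bigr => i _; rewrite natz.
Qed.

Lemma qintE k : qint k = npoly (nseq k 1%num).
Proof.
rewrite /qint -(big_mkord xpredT (fun i => 'X^i)) /index_iota subn0.
have H n i : nseq n 1%num = [seq N.of_nat 1 | _ <- iota i n].
  by elim: n i => //= n IH i; rewrite -IH.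
by rewrite (H k 0%N) (npoly_iota (fun=> 1%N)); apply: eq_bigr => i _; rewrite scale1r.
Qed.
End BinaryPoly.

Definition shape (k : nat) : seq N :=
  [seq N.of_nat (dim (stage k) d) | d <- iota 0 (size (stage k))].

Fixpoint basis_shape (k : nat) : seq N :=
  if k is k'.+1 then nmul (shape k) (basis_shape k') else [:: 1%num].

(** Length is additive on [u ++ h], so the Hilbert series of the stage modules multiply. *)
Lemma basis_shapeE k : \sum_(w <- basis k) 'X^(size w) = npoly (basis_shape k).
Proof.
elim: k => [|k IH].
  by rewrite big_seq1 -[npoly _]/(npoly (nseq 1 1%num)) -qintE /qint big_ord1.
rewrite [basis_shape _]/= npolyM -IH [basis _]/= big_allpairs_dep /= /shape npoly_iota.
rewrite /stage_words big_allpairs_dep mulr_suml; apply: eq_bigr => d _.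
transitivity (\sum_(i <- iota 0 (dim (stage k.+1) d))
   'X^d * \sum_(h <- basis k) 'X^(size h) : {poly int}).
  apply: eq_bigr => i _; rewrite mulr_sumr; apply: eq_bigr => h _.
  by rewrite size_cat size_bword exprD.
rewrite big_const_seq count_predT size_iota iter_addr_0 scaler_nat.
by rewrite mulrnAl.
Qed.

(** With the denominator cleared the claim is an identity of polynomials, whose coefficients are the
    convolution sums in [hilb_is]. *)
Lemma tree_hilbert k (P Q : {poly int}) (s t : seq N) : (4 < k < 8)%N ->
  Q = npoly s -> P = npoly t -> nmul (basis_shape k) s = t -> hilb_is (Egraph k.+1) P Q.
Proof.
move=> k57 -> -> <-; exists (fun d => count (fun b => size b == d) (basis k)).
split=> d; first exact: (tree_dim k57 d).
rewrite npolyM -basis_shapeE coefMr; apply: eq_bigr => i _; congr (_ * _).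
rewrite coef_sum -sum1_count -natz natr_sum [RHS](eq_bigr (fun b => (size b == (d - i)%N)%:R)).
  by rewrite big_mkcond; apply: eq_bigr => b _; case: eqP.
by move=> b _; rewrite coefXn eq_sym.
Qed.

Theorem mainTheorem17 :
  (forall m : nat, m \in [:: 6%N; 7%N; 8%N] -> relations_generated (Egraph m)) /\
  hilb_is (Egraph 6)
    (qint 4 * qint 5 * qint 6 ^+ 2 * qint 8 * qint 9) (qint 3) /\
  hilb_is (Egraph 7)
    (qint 6 ^+ 2 * qint 8 * qint 9 * qint 10 * qint 12 * qint 14) (qint 3) /\
  hilb_is (Egraph 8)
    (qint 6 * qint 8 * qint 10 * qint 12 * qint 14 * qint 15 * qint 18 * qint 20 * qint 24)
    (qint 3 * qint 5).
Proof.
split; first by case=> [|k] //; rewrite !inE => /or3P[] /eqP[->]; apply: tree_relations.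
rewrite !expr2 !qintE -!npolyM; split; [|split];
  by apply: tree_hilbert erefl erefl _ => //; vm_compute.
Qed.
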